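(* Let $G$ be a finite simple connected, locally connected graph with minimum degree at least $2$, maximum degree $\Delta(G)=5$ or $6$, and minimum clustering coefficient $\xi(G)\ge\tfrac12$. Then $G$ is fully cycle extendable if and only if $G$ is not isomorphic to any of $F_1,F_2,F_3,F_4$ and $G$ does not contain any of $H_1,\dots,H_5$ as a strongly induced subgraph with the corresponding attachment set $S_1,\dots,S_5$.
   Context: For a vertex $v$, $N(v)$ is its open neighbourhood and $\langle S\rangle$ the subgraph induced by $S$. $G$ is locally connected if $\langle N(v)\rangle$ is connected for every vertex $v$. The clustering coefficient of a vertex $v$ of degree $k\ge 2$ is $\xi(v)=|E(\langle N(v)\rangle)|/\binom{k}{2}$, and $\xi(G)=\min_v\xi(v)$. A cycle $C$ is extendable if there is a cycle $C'$ with $V(C')=V(C)\cup\{y\}$ for a single vertex $y\notin V(C)$. $G$ is fully cycle extendable if every vertex lies on a triangle and every cycle of $G$ not containing all vertices of $G$ is extendable. Strongly induced subgraph: a subgraph $H$ with $S\subseteq V(H)$ is a strongly induced subgraph of $G$ with attachment set $S$ if $H$ is induced in $G$ and every edge of $G$ incident with a vertex of $V(H)-S$ belongs to $H$. ''$G$ contains $H_i$ as a strongly induced subgraph with attachment set $S_i$'' means $G$ has such a subgraph $H$ with attachment set $S$ and an isomorphism $H\to H_i$ mapping $S$ onto $S_i$. The graphs $H_i$ (with attachment sets): $H_1$: vertices $a,b,u,w,p,q$; $\{a,b,u,w\}$ pairwise adjacent; $p,q$ each adjacent exactly to $a,b$; $S_1=\{u,w\}$. $H_2$: vertices $a,b,u,w,z,p,q$;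 $\{a,b,u,w,z\}$ pairwise adjacent; $p,q$ each adjacent exactly to $a,b$; $S_2=\{u,w,z\}$. $H_3$: vertices $a,b,c,p,q,r,s$; $a,b,c$ pairwise adjacent; $p$ adjacent exactly to $a,b$; each of $q,r,s$ adjacent exactly to $a,b,c$; $S_3=\{c,s\}$. $H_4$: vertices $a,b,c,u,w,p,q,r$; $\{a,b,c,u,w\}$ pairwise adjacent; $p$ adjacent exactly to $a,b$; $q$ exactly to $b,c$; $r$ exactly to $c,a$; $S_4=\{u,w\}$. $H_5$: vertices $a,b,c,x,u,w,p,r$; $a,b,c$ pairwise adjacent; $x$ adjacent exactly to $a,b,c$; $p$ exactly to $b,c$; $r$ exactly to $c,a$; $u$ adjacent to $a,b,w$; $w$ adjacent to $a,b,c,u$; no other edges; $S_5=\{u,w\}$. The graphs $F_i$: $F_1=K_3+\overline{K}_4$ (join of a triangle with four independent vertices). $F_2$: vertices $a,b,c,d,p_1,p_2,p_3$; $a,b,c$ pairwise adjacent; $d$ adjacent exactly to $a,b,c$; $p_1,p_2,p_3$ adjacent exactly to $\{a,b\},\{b,c\},\{c,a\}$ respectively. $F_3$: vertices $a_0,a_1,a_2,a_3,d,p_0,p_1,p_2,p_3$; $a_0,\dots,a_3$ pairwise adjacent; $d$ adjacent exactly to $a_0,\dots,a_3$; $p_i$ adjacent exactly to $a_i$ and $a_{i+1}$ (indices mod 4). $F_4$: vertices $a_0,a_1,a_2,a_3,y,z,p_1,p_2,p_3$; $a_0,\dots,a_3$ pairwise adjacent; $y$ adjacent exactly to $a_0,a_1,a_2$;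 $z$ adjacent exactly to $a_0,a_1,a_3$; $p_1,p_2,p_3$ adjacent exactly to $\{a_1,a_2\},\{a_2,a_3\},\{a_3,a_0\}$ respectively. *)

(* Defs.v *)
From HB Require Import structures.
From mathcomp Require Import all_boot all_order all_algebra.

Set Implicit Arguments.
Unset Strict Implicit.
Unset Printing Implicit Defensive.

Import Order.TTheory GRing.Theory Num.Theory.

Structure sgraph := SGraph {
  vertex :> finType;
  adj : rel vertex;
  adj_sym : symmetric adj;
  adj_irr : irreflexive adj }.

Arguments adj {G} : rename.

Notation "x -- y" := (adj x y) (at level 30, no associativity).

Definition graph_iso (G H : sgraph) (f : G -> H) : Prop :=
  bijective f /\ {mono f : x y / x -- y}.

Definition isomorphic (G H : sgraph) : Prop :=
  exists f : G -> H, graph_iso f.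

Section Induced.
Variables (G : sgraph) (W : {set G}).

Definition induced_adj : rel {x : G | x \in W} :=
  fun x y => val x -- val y.

Lemma induced_adj_sym : symmetric induced_adj.
Proof. by move=> x y; rewrite /induced_adj adj_sym. Qed.

Lemma induced_adj_irr : irreflexive induced_adj.
Proof. by move=> x; rewrite /induced_adj adj_irr. Qed.

Definition induced : sgraph := SGraph induced_adj_sym induced_adj_irr.
End Induced.

Section Invariants.
Variable G : sgraph.

Definition edges : {set {set G}} :=
  [set A : {set G} | [exists x, exists y, (x -- y) && (A == [set x; y])]].

Definition nbhd (v : G) : {set G} := [set x | v -- x].

Definition degree (v : G) : nat := #|nbhd v|.

Definition max_degree : nat := \max_(v : G) degree v.

(* Every degree is below #|G|, so the default value is irrelevant as soon as
   G has a vertex. *)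
Definition min_degree : nat := \big[minn/#|G|]_(v : G) degree v.

Definition connected : Prop := forall x y : G, connect adj x y.
End Invariants.

Definition locally_connected (G : sgraph) : Prop :=
  forall v : G, connected (induced (nbhd v)).

Definition clustering (G : sgraph) (v : G) : rat :=
  (#|edges (induced (nbhd v))|%:R / 'C(degree v, 2)%:R)%R.

(* Every clustering coefficient is at most 1, so the default value is
   irrelevant as soon as G has a vertex. *)
Definition min_clustering (G : sgraph) : rat :=
  \big[Order.min/1%R]_(v : G) clustering v.

Section Cycles.
Variable G : sgraph.

(* A cycle is given by the cyclic sequence of its vertices. *)
Definition is_cycle (c : seq G) : bool := (2 < size c) && ucycleb adj c.

Definition extendable (c : seq G) : Prop :=
  exists (y : G) (c' : seq G), [/\ y \notin c, is_cycle c' & c' =i y :: c].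

Definition on_triangle (v : G) : Prop :=
  exists x y : G, [/\ v -- x, x -- y & y -- v].

Definition fully_cycle_extendable : Prop :=
  (forall v : G, on_triangle v) /\
  (forall c : seq G, is_cycle c -> (exists v : G, v \notin c) -> extendable c).
End Cycles.

(* An induced subgraph is identified with its vertex set W; an edge of G then
   belongs to it exactly when both its ends are in W. *)
Definition strongly_induced (G : sgraph) (W S : {set G}) : Prop :=
  S \subset W /\
  (forall x y : G, x \in W :\: S -> x -- y -> y \in W).

Definition contains_strongly_induced (G H : sgraph) (SH : {set H}) : Prop :=
  exists W S : {set G}, strongly_induced W S /\
    exists f : induced W -> H,
      graph_iso f /\ f @: [set x : induced W | val x \in S] = SH.

Arguments contains_strongly_induced G H SH : clear implicits.

(* [clique_ext k L] has vertices 0, 1, ..., k + size L - 1, of which 0, ..., k-1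
   are pairwise adjacent; the i-th list of L contains the neighbours of the
   vertex k + i among the vertices smaller than k + i. *)
Section CliqueExt.
Variables (k : nat) (L : seq (seq nat)).

Definition below (i j : nat) : bool :=
  (i < j) && ((j < k) || (i \in nth [::] L (j - k))).

Definition clique_ext_adj : rel 'I_(k + size L) :=
  fun i j => below i j || below j i.

Lemma clique_ext_sym : symmetric clique_ext_adj.
Proof. by move=> i j; rewrite /clique_ext_adj orbC. Qed.

Lemma clique_ext_irr : irreflexive clique_ext_adj.
Proof. by move=> i; rewrite /clique_ext_adj /below ltnn. Qed.

Definition clique_ext : sgraph := SGraph clique_ext_sym clique_ext_irr.

Definition clique_ext_set (s : seq nat) : {set clique_ext} :=
  [set i : 'I_(k + size L) | val i \in s].
End CliqueExt.

Arguments clique_ext_set {k L} s.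

(* a, b, u, w, p, q = 0, ..., 5 *)
Definition H1 : sgraph := clique_ext 4 [:: [:: 0; 1]; [:: 0; 1]].
Definition S1 : {set H1} := clique_ext_set [:: 2; 3].

(* a, b, u, w, z, p, q = 0, ..., 6 *)
Definition H2 : sgraph := clique_ext 5 [:: [:: 0; 1]; [:: 0; 1]].
Definition S2 : {set H2} := clique_ext_set [:: 2; 3; 4].

(* a, b, c, p, q, r, s = 0, ..., 6 *)
Definition H3 : sgraph :=
  clique_ext 3 [:: [:: 0; 1]; [:: 0; 1; 2]; [:: 0; 1; 2]; [:: 0; 1; 2]].
Definition S3 : {set H3} := clique_ext_set [:: 2; 6].

(* a, b, c, u, w, p, q, r = 0, ..., 7 *)
Definition H4 : sgraph :=
  clique_ext 5 [:: [:: 0; 1]; [:: 1; 2]; [:: 2; 0]].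
Definition S4 : {set H4} := clique_ext_set [:: 3; 4].

(* a, b, c, x, p, r, u, w = 0, ..., 7 *)
Definition H5 : sgraph :=
  clique_ext 3 [:: [:: 0; 1; 2]; [:: 1; 2]; [:: 2; 0]; [:: 0; 1];
                   [:: 0; 1; 2; 6]].
Definition S5 : {set H5} := clique_ext_set [:: 6; 7].

Section Join.
Variables G H : sgraph.

Definition join_adj : rel (G + H)%type := fun x y =>
  match x, y with
  | inl x1, inl y1 => x1 -- y1
  | inr x2, inr y2 => x2 -- y2
  | _, _ => true
  end.

Lemma join_adj_sym : symmetric join_adj.
Proof. by move=> [x|x] [y|y] //=; rewrite adj_sym. Qed.

Lemma join_adj_irr : irreflexive join_adj.
Proof. by move=> [x|x] /=; rewrite adj_irr. Qed.

Definition join : sgraph := SGraph join_adj_sym join_adj_irr.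
End Join.

Lemma complete_sym n : symmetric (fun i j : 'I_n => i != j).
Proof. by move=> i j; rewrite eq_sym. Qed.

Lemma complete_irr n : irreflexive (fun i j : 'I_n => i != j).
Proof. by move=> i; rewrite eqxx. Qed.

Definition complete (n : nat) : sgraph :=
  SGraph (@complete_sym n) (@complete_irr n).

Section Complement.
Variable G : sgraph.

Definition compl_adj : rel G := fun x y => (x != y) && ~~ (x -- y).

Lemma compl_adj_sym : symmetric compl_adj.
Proof. by move=> x y; rewrite /compl_adj eq_sym adj_sym. Qed.

Lemma compl_adj_irr : irreflexive compl_adj.
Proof. by move=> x; rewrite /compl_adj eqxx. Qed.

Definition complement : sgraph := SGraph compl_adj_sym compl_adj_irr.
End Complement.

Definition F1 : sgraph := join (complete 3) (complement (complete 4)).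

(* a, b, c, d, p_1, p_2, p_3 = 0, ..., 6 *)
Definition F2 : sgraph :=
  clique_ext 3 [:: [:: 0; 1; 2]; [:: 0; 1]; [:: 1; 2]; [:: 2; 0]].

(* a_0, a_1, a_2, a_3, d, p_0, p_1, p_2, p_3 = 0, ..., 8 *)
Definition F3 : sgraph :=
  clique_ext 4 [:: [:: 0; 1; 2; 3];
                   [:: 0; 1]; [:: 1; 2]; [:: 2; 3]; [:: 3; 0]].

(* a_0, a_1, a_2, a_3, y, z, p_1, p_2, p_3 = 0, ..., 8 *)
Definition F4 : sgraph :=
  clique_ext 4 [:: [:: 0; 1; 2]; [:: 0; 1; 3];
                   [:: 1; 2]; [:: 2; 3]; [:: 3; 0]].

(* Main.v *)
(* Necessity: in a fully cycle extendable graph a triangle extends step by step to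
   a spanning cycle, but each F_i and H_i contains k vertices all of whose
   neighbours lie among k others, and yet another vertex, so that a spanning cycle
   would close up too early.

   Sufficiency: let C be a cycle that neither spans nor extends. By connectivity
   and local connectivity there is a triangle x y z with x and z on C and y off C.
   From here on a finite case distinction leads to a contradiction. A case records
   which of finitely many named vertices are adjacent, which have no unnamed
   neighbours, and in which order C visits them. Cases are split by asking whether
   two named vertices are adjacent, whether a vertex has a further neighbour (and
   where it lies), which vertex follows another on C, or which edge makes a
   neighbourhood connected. A case is finished when a neighbourhood violates the
   bound on the degree or the clustering coefficient, when the named vertices and
   the segments of C between them can be rearranged into a cycle with one more
   vertex, when an F_i or H_i appears, or when all vertices are named and have
   degree at most 4. The tree of cases is checked by computation. Its size is kept
   down by first excluding the cases where x has degree 6, then degree 5, so that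
   z and the other vertices in the role of x have small degree afterwards. *)

From Stdlib Require Import String Ascii.
Require Import Defs.
From mathcomp Require Import all_boot all_order all_algebra.

Set Implicit Arguments.
Unset Strict Implicit.
Unset Printing Implicit Defensive.

Import Order.TTheory GRing.Theory Num.Theory.

(** * Partial descriptions of a graph around a cycle *)

Definition vrow := (bool * seq (option bool))%type.
(** Default row: lookups beyond the numbered vertices assert nothing. *)
Definition norow : vrow := (false, [::]).

(* What is known around a cycle of G, some vertices of which have been given
   numbers. Row u consists of a flag, set when all neighbours of u are numbered,
   and of the known adjacencies between u and each v < u. The list cyc gives the
   numbered vertices of the cycle in cyclic order; the flag of a vertex tells
   whether unnumbered vertices may occur between it and the next one (a gap). *)
Record state := State { rows : seq vrow; cyc : seq (nat * bool) }.

Definition nvert (st : state) : nat := size (rows st).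
Definition named (st : state) : seq nat := iota 0 (nvert st).
Definition on_cyc (st : state) : seq nat := [seq p.1 | p <- cyc st].

Definition entry (rs : seq vrow) (u v : nat) : option bool :=
  if v < u then nth None (nth norow rs u).2 v
  else if u < v then nth None (nth norow rs v).2 u else None.

Definition known (b : bool) (st : state) (u v : nat) : bool :=
  if entry (rows st) u v is Some b' then eqb b b' else false.

Definition shut (st : state) (u : nat) : bool := (nth norow (rows st) u).1.

Definition put_row (rs : seq vrow) (u v : nat) (b : bool) : seq vrow :=
  set_nth norow rs u
    ((nth norow rs u).1, set_nth None (nth norow rs u).2 v (Some b)).

Definition put (rs : seq vrow) (u v : nat) (b : bool) : seq vrow :=
  if v < u then put_row rs u v b else put_row rs v u b.

(** * Case distinctions on states *)

(** The empty list means that the opposite adjacency is already recorded, so a contradictory case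
    simply disappears. *)
Definition set_edge (u v : nat) (b : bool) (st : state) : seq state :=
  match entry (rows st) u v with
  | Some b' => if eqb b b' then [:: st] else [::]
  | None => [:: State (put (rows st) u v b) (cyc st)]
  end.

Definition close (v : nat) (st : state) : state :=
  State (set_nth norow (rows st) v (true, (nth norow (rows st) v).2)) (cyc st).

(** All neighbours of a closed vertex already have numbers, so a vertex numbered later is not
    adjacent to it. *)
Definition fresh_vrow (st : state) : vrow :=
  (false, [seq if r.1 then Some false else None | r <- rows st]).

Definition add_off (st : state) : state :=
  State (rcons (rows st) (fresh_vrow st)) (cyc st).

Fixpoint cyc_insert (u : nat) (b1 : bool) (w : nat) (b2 : bool)
    (l : seq (nat * bool)) : seq (nat * bool) :=
  if l is p :: l' then
    if p.1 == u then (u, b1) :: (w, b2) :: l'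
    else p :: cyc_insert u b1 w b2 l'
  else [::].

Definition add_on (u : nat) (b1 b2 : bool) (st : state) : state :=
  State (rcons (rows st) (fresh_vrow st))
        (cyc_insert u b1 (nvert st) b2 (cyc st)).

(** The new vertex lies off the cycle or inside a gap; in a gap, unnumbered vertices may remain on
    both sides of it. *)
Definition add_new (st : state) : seq state :=
  add_off st :: [seq add_on p.1 true true st | p <- cyc st & p.2].

Definition bind (T : Type) (s : seq T) (k : T -> seq state) : seq state :=
  flatten [seq k x | x <- s].

Definition split_edge (u v : nat) (st : state) : option (seq state) :=
  if [&& u < nvert st, v < nvert st & u != v]
  then Some (set_edge u v true st ++ set_edge u v false st) else None.

Definition new_nbr (v : nat) (st : state) : option (seq state) :=
  if v < nvert st then
    Some (close v st :: bind (add_new st) (set_edge v (nvert st) true))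
  else None.

Definition cyc_direct (u : nat) (st : state) : state :=
  State (rows st) [seq (p.1, if p.1 == u then false else p.2) | p <- cyc st].

(* The gap after u is empty, or its first (if [after]) or last vertex gets a
   number. *)
Definition next_gap (after : bool) (u : nat) (st : state) :
    option (seq state) :=
  let v := next (on_cyc st) u in
  if ((u, true) \in cyc st) && (u != v) then
    Some (set_edge u v true (cyc_direct u st) ++
          set_edge (if after then u else v) (nvert st) true
                   (add_on u (~~ after) after st))
  else None.

(** Meant for a vertex all of whose neighbours are recorded, so that every adjacency not known to
    hold fails. *)
Definition fill_nonnbrs (v : nat) (st : state) : state :=
  foldl (fun s u => if (u != v) && ~~ known true st v u
                    then State (put (rows s) v u false) (cyc s) else s)
        st (named st).

Definition close_full (v : nat) (st : state) : option (seq state) :=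
  let d := count (known true st v) (named st) in
  if 6 < d then Some [::]
  else if (d == 6) && (v < nvert st) then Some [:: close v (fill_nonnbrs v st)]
  else None.

(* Local connectivity at v: if K meets the neighbourhood of v without containing
   it, then an edge of that neighbourhood leaves K. *)
Definition connect_nbrs (v : nat) (K : seq nat) (st : state) :
    option (seq state) :=
  let out := [seq b <- named st | b \notin K] in
  if [&& v < nvert st, v \notin K, all (gtn (nvert st)) K,
         has (known true st v) K & has (known true st v) out] then
    Some (bind K (fun a => bind (set_edge v a true st) (fun s1 =>
      bind [seq b <- out | b != v]
        (fun b => bind (set_edge v b true s1) (set_edge a b true)) ++
      bind (add_new s1) (fun s2 =>
        bind (set_edge v (nvert st) true s2) (set_edge a (nvert st) true)))))
  else None.

(** Reversal shifts the flags: the gap after a vertex is then the one that preceded it. [b] is the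
    flag of the vertex before [l]. *)
Fixpoint rev_links (b : bool) (l : seq (nat * bool)) : seq (nat * bool) :=
  if l is p :: l' then rcons (rev_links p.2 l') (p.1, b) else [::].

Definition reverse (st : state) : state :=
  State (rows st) (rev_links (last false [seq p.2 | p <- cyc st]) (cyc st)).

(** * Conditions that close a case *)

Definition gaps (st : state) : seq (nat * nat) :=
  [seq (p.1, next (on_cyc st) p.1) | p <- cyc st & p.2].

(** A gap is identified by its first end in the order of [cyc]; a link may run through it in either
    direction. *)
Definition used_gaps (gs : seq (nat * nat)) (p : nat * nat) : seq nat :=
  if p \in gs then [:: p.1]
  else if (p.2, p.1) \in gs then [:: p.2] else [::].

(* p lists a vertex off the cycle and then all numbered vertices of the cycle, in
   the order in which the longer cycle visits them. Every gap has to be traversed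
   once, in either direction. *)
Definition extends (p : seq nat) (st : state) : bool :=
  if p is y :: ws then
    let gs := gaps st in
    let links := zip p (rcons ws y) in
    let used := flatten [seq used_gaps gs q | q <- links] in
    [&& 2 < size p, y < nvert st, y \notin on_cyc st,
        all (fun u => u \in ws) (on_cyc st), size ws <= size (cyc st),
        all (fun q => (q \in gs) || ((q.2, q.1) \in gs) || known true st q.1 q.2)
            links,
        all (fun q => q.1 \in used) gs & size used <= size gs]
  else false.

Fixpoint nonadj_pairs (T : Type) (r : rel T) (s : seq T) : nat :=
  if s is a :: s' then count (r a) s' + nonadj_pairs r s' else 0.

(* A vertex of degree d > 1 with clustering coefficient at least 1/2 has at most
   ['C(d, 2)./2] nonadjacent pairs of neighbours; for d < 2 the coefficient is
   0 / 0 = 0. *)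
Definition sparse (v : nat) (st : state) : bool :=
  let d := if shut st v
           then minn 6 (count (fun u => (u != v) && ~~ known false st v u)
                          (named st))
           else 6 in
  (v < nvert st) &&
  ((d < 2) ||
   ('C(d, 2)./2 < nonadj_pairs (known false st)
                    [seq u <- named st | known true st v u])).

Definition shut_within (X : seq nat) (st : state) (u : nat) : bool :=
  shut st u &&
  all (fun w => [|| w \in X, w == u | known false st u w]) (named st).

(* [clique_ext psize pext] with the attachment set pattach. *)
Record pattern := Pattern {
  psize : nat; pext : seq (seq nat); pattach : seq nat }.

Definition pattern_at (P : pattern) (m : seq nat) (st : state) : bool :=
  let k := psize P in let L := pext P in
  [&& size m == k + size L, uniq m, all (gtn (nvert st)) m,
      all (fun j => all (fun i =>
             known (below k L i j) st (nth 0 m i) (nth 0 m j)) (iota 0 j))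
          (iota 0 (size m))
    & all (fun j => (j \in pattach P) || shut_within m st (nth 0 m j))
          (iota 0 (size m))].

Definition small (st : state) : bool :=
  all (fun v => shut st v &&
    (count (fun u => (u != v) && ~~ known false st v u) (named st) <= 4))
    (named st).

(* Every kept vertex is paired with the block of dropped vertices after it; the
   first component is the block before the first kept vertex. *)
Definition thin (keep : pred nat) (l : seq (nat * bool)) :
    seq (nat * bool) * seq ((nat * bool) * seq (nat * bool)) :=
  foldr (fun p acc => if keep p.1 then ([::], (p, acc.1) :: acc.2)
                      else (p :: acc.1, acc.2)) ([::], [::]) l.

(* st describes a special case of T, vertex i of T being vertex [nth 0 m i]. *)
Definition instance (T : state) (m : seq nat) (st : state) : bool :=
  let k := nvert T in
  let c := rot (index (nth 0 m (head 0 (on_cyc T))) (on_cyc st)) (cyc st) in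
  let bl := thin (fun u => u \in [seq nth 0 m i | i <- on_cyc T]) c in
  [&& size m == k, uniq m, all (gtn (nvert st)) m,
      all (fun u => all (fun v =>
             if entry (rows T) u v is Some b
             then known b st (nth 0 m u) (nth 0 m v) else true) (iota 0 u))
          (iota 0 k),
      all (fun u => shut T u ==> shut_within m st (nth 0 m u)) (iota 0 k),
      all (fun u => (u \in on_cyc T) == (nth 0 m u \in on_cyc st)) (iota 0 k),
      all (gtn k) (on_cyc T),
      nilp bl.1, size bl.2 == size (cyc T)
    & all2 (fun t b => (b.1.1 == nth 0 m t.1) &&
              (t.2 || (~~ b.1.2 && nilp b.2))) (cyc T) bl.2].

(** * Certificates and their execution *)

Definition digit (c : ascii) : option nat :=
  match c with
  | "0" => Some 0 | "1" => Some 1 | "2" => Some 2 | "3" => Some 3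
  | "4" => Some 4 | "5" => Some 5 | "6" => Some 6 | "7" => Some 7
  | "8" => Some 8 | "9" => Some 9 | "a" => Some 10 | "b" => Some 11
  | "c" => Some 12 | "d" => Some 13 | "e" => Some 14 | "f" => Some 15
  | _ => None
  end%char.

(* H1, ..., H5, F1, ..., F4 *)
Definition patterns : seq pattern := [::
  Pattern 4 [:: [:: 0; 1]; [:: 0; 1]] [:: 2; 3];
  Pattern 5 [:: [:: 0; 1]; [:: 0; 1]] [:: 2; 3; 4];
  Pattern 3 [:: [:: 0; 1]; [:: 0; 1; 2]; [:: 0; 1; 2]; [:: 0; 1; 2]] [:: 2; 6];
  Pattern 5 [:: [:: 0; 1]; [:: 1; 2]; [:: 2; 0]] [:: 3; 4];
  Pattern 3 [:: [:: 0; 1; 2]; [:: 1; 2]; [:: 2; 0]; [:: 0; 1]; [:: 0; 1; 2; 6]]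
          [:: 6; 7];
  Pattern 3 [:: [:: 0; 1; 2]; [:: 0; 1; 2]; [:: 0; 1; 2]; [:: 0; 1; 2]] [::];
  Pattern 3 [:: [:: 0; 1; 2]; [:: 0; 1]; [:: 1; 2]; [:: 2; 0]] [::];
  Pattern 4 [:: [:: 0; 1; 2; 3]; [:: 0; 1]; [:: 1; 2]; [:: 2; 3]; [:: 3; 0]] [::];
  Pattern 4 [:: [:: 0; 1; 2]; [:: 0; 1; 3]; [:: 1; 2]; [:: 2; 3]; [:: 3; 0]] [::]].

Definition leaf (b : bool) : option (seq state) :=
  if b then Some [::] else None.

Variant op :=
  | Split | Neighbour | After | Before | Full | Connect | Reverse
  | Extends | Sparse | Small | Occurs | Instance.

Definition op_of (c : ascii) : option op :=
  match c with
  | "A" => Some Split | "N" => Some Neighbour | "G" => Some After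
  | "B" => Some Before | "K" => Some Full | "C" => Some Connect
  | "R" => Some Reverse | "E" => Some Extends | "U" => Some Sparse
  | "S" => Some Small | "P" => Some Occurs | "L" => Some Instance
  | _ => None
  end%char.

Definition step (lemmas : seq state) (o : op) (args : seq nat)
    (st : state) : option (seq state) :=
  match o, args with
  | Split, [:: u; v] => split_edge u v st
  | Neighbour, [:: v] => new_nbr v st
  | After, [:: u] => next_gap true u st
  | Before, [:: u] => next_gap false u st
  | Full, [:: v] => close_full v st
  | Connect, v :: K => connect_nbrs v K st
  | Reverse, [::] => Some [:: reverse st]
  | Extends, p => leaf (extends p st)
  | Sparse, [:: v] => leaf (sparse v st)
  | Small, [::] => leaf (small st)
  | Occurs, i :: m =>
    if onth patterns i is Some P then leaf (pattern_at P m st) else None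
  | Instance, i :: m =>
    if onth lemmas i is Some T then leaf (instance T m st) else None
  | _, _ => None
  end.

Definition blank (c : ascii) : bool :=
  match c with " " | "010" => true | _ => false end%char.

(* A certificate is a tree of case distinctions in prefix order: the arguments of
   a step precede its letter, and the stack holds the cases still open. *)
Fixpoint run (lemmas : seq state) (cert : string) (args : seq nat)
    (stack : seq state) : bool :=
  match cert with
  | EmptyString => nilp stack
  | String c cert' =>
    if digit c is Some d then run lemmas cert' (d :: args) stack
    else if blank c then run lemmas cert' args stack
    else if (op_of c, stack) is (Some o, st :: stack') then
      if step lemmas o (rev args) st is Some sts
      then run lemmas cert' [::] (sts ++ stack') else false
    else false
  end.

Fixpoint run_all (lemmas : seq state) (certs : seq (state * string)) : bool :=
  if certs is (st, cert) :: certs' then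
    run lemmas cert [::] [:: st] && run_all (rcons lemmas st) certs'
  else true.

(** * Soundness of the case distinctions *)

Lemma entry_sym rs u v : entry rs u v = entry rs v u.
Proof. by rewrite /entry; case: (ltngtP u v). Qed.

Lemma entry_put rs u v b u' v' : u != v ->
  entry (put rs u v b) u' v' =
  if ((u', v') == (u, v)) || ((u', v') == (v, u)) then Some b
  else entry rs u' v'.
Proof.
wlog ltvu : u v / v < u.
  move=> W neq; case: (ltngtP v u) (neq) => [h _|h _|->]; last by [].
    exact: W.
  have -> : put rs u v b = put rs v u b by rewrite /put; case: (ltngtP u v) h.
  by rewrite W // 1?eq_sym // orbC.
move=> _; rewrite /put ltvu.
wlog le' : u' v' / v' <= u'.
  move=> W; case: (leqP v' u') => [|/ltnW] h; first exact: W.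
  by rewrite entry_sym (W v' u' h) [entry rs v' u']entry_sym !xpair_eqE orbC
             andbC [(v' == _) && _]andbC.
have [lt'|ge'] := ltnP v' u'; last first.
  have -> : u' = v' by apply/eqP; rewrite eqn_leq ge' le'.
  rewrite !xpair_eqE andbC orbb /entry ltnn.
  by case: eqP => //= ->; rewrite (ltn_eqF ltvu).
rewrite /entry lt' /put_row nth_set_nth /= !xpair_eqE.
have -> : (u' == v) && (v' == u) = false.
  by apply/negP => /andP[/eqP e1 /eqP e2]; move: lt'; rewrite e1 e2 ltnNge ltnW.
by rewrite orbF; case: eqP => [->|] //=; rewrite nth_set_nth /=; case: eqP.
Qed.

Lemma size_put rs u v b :
  u < size rs -> v < size rs -> size (put rs u v b) = size rs.
Proof.
by rewrite /put /put_row => hu hv; case: ifP; rewrite size_set_nth; move=> _;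
  apply/maxn_idPr.
Qed.

Lemma shut_put rs u v b w :
  (nth norow (put rs u v b) w).1 = (nth norow rs w).1.
Proof.
by rewrite /put /put_row; case: ifP => _; rewrite nth_set_nth /=; case: eqP => [->|].
Qed.

(** * Realizations of a state in a graph *)

Section Soundness.
Variable G : sgraph.
Implicit Types (f : nat -> G) (g : nat -> seq G) (st : state).

Definition expand f g (l : seq (nat * bool)) : seq G :=
  flatten [seq f p.1 :: g p.1 | p <- l].

Definition stuck (c : seq G) : Prop := is_cycle c /\ ~ extendable c.

(* f u is the vertex with number u, and g u is the sequence of unnumbered vertices
   of the cycle between f u and the next numbered one. *)
Record realizes f g st : Prop := Realizes {
  real_inj : forall u v, u < nvert st -> v < nvert st -> f u = f v -> u = v;
  real_entry : forall u v b, u < nvert st -> v < nvert st ->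
    entry (rows st) u v = Some b -> (f u -- f v) = b;
  real_shut : forall u x, u < nvert st -> shut st u -> f u -- x ->
    exists2 v, v < nvert st & x = f v;
  real_stuck : stuck (expand f g (cyc st));
  real_seg : forall p, p \in cyc st -> ~~ p.2 -> g p.1 = [::];
  real_on : forall u, u < nvert st ->
    (f u \in expand f g (cyc st)) = (u \in on_cyc st);
  real_lt : forall u, u \in on_cyc st -> u < nvert st }.

Definition refuted st : Prop := forall f g, ~ realizes f g st.

Fixpoint refuted_all (l : seq state) : Prop :=
  if l is st :: l' then refuted st /\ refuted_all l' else True.

Lemma refuted_all_cat l1 l2 :
  refuted_all (l1 ++ l2) <-> refuted_all l1 /\ refuted_all l2.
Proof. by elim: l1 => /= [|st l1 ->]; tauto. Qed.

Lemma refuted_bind (T : eqType) (s : seq T) k x :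
  refuted_all (bind s k) -> x \in s -> refuted_all (k x).
Proof.
elim: s => //= y s IH /refuted_all_cat[hy hs].
by rewrite in_cons => /predU1P[->|/IH]; last exact.
Qed.

Lemma bind1 st k : bind [:: st] k = k st.
Proof. by rewrite /bind /= cats0. Qed.

Lemma bind_id l : bind l (fun st => [:: st]) = l.
Proof. exact: flatten_seq1. Qed.

Lemma knownP f g st b u v : realizes f g st -> u < nvert st -> v < nvert st ->
  known b st u v -> (f u -- f v) = b.
Proof.
move=> R hu hv; rewrite /known; case E: (entry _ _ _) => [b'|] // /eqP->.
exact: real_entry R _ _ _ hu hv E.
Qed.

Lemma realizes_rows f g st rs : realizes f g st -> size rs = nvert st ->
  (forall u v b, u < nvert st -> v < nvert st ->
     entry rs u v = Some b -> (f u -- f v) = b) ->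
  (forall u x, u < nvert st -> (nth norow rs u).1 -> f u -- x ->
     exists2 v, v < nvert st & x = f v) ->
  realizes f g (State rs (cyc st)).
Proof.
move=> R Es He Hs; case: R => r1 r2 r3 r4 r5 r6 r7.
by split=> //; rewrite /nvert /= ?Es //; move=> *; apply: r1; rewrite ?Es.
Qed.

Lemma realizes_put f g st u v b : realizes f g st ->
  u < nvert st -> v < nvert st -> u != v -> (f u -- f v) = b ->
  realizes f g (State (put (rows st) u v b) (cyc st)).
Proof.
move=> R hu hv neq E; apply: realizes_rows (R) _ _ _; first by rewrite size_put.
  move=> u' v' b' hu' hv'; rewrite entry_put // !xpair_eqE.
  case: orP => [|_]; last exact: real_entry R _ _ _ hu' hv'.
  by case=> /andP[/eqP-> /eqP->] [<-] //; rewrite adj_sym.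
move=> u' x hu'; rewrite shut_put => h.
exact: (real_shut R hu' h).
Qed.

(** [set_edge] keeps the case that holds in [G], so a realized state survives. The continuation [k]
    allows such steps to be chained inside [bind]. *)
Lemma set_edgeP f g st u v b k : realizes f g st ->
  u < nvert st -> v < nvert st -> u != v -> (f u -- f v) = b ->
  refuted_all (bind (set_edge u v b st) k) ->
  exists st', [/\ realizes f g st', nvert st' = nvert st, cyc st' = cyc st
                & refuted_all (k st')].
Proof.
move=> R hu hv neq E; rewrite /set_edge; case Ee: (entry _ _ _) => [b'|].
  have -> : b' = b by rewrite -(real_entry R hu hv Ee).
  by rewrite eqbE eqxx bind1 => h; exists st.
rewrite bind1 => h; eexists; split; last exact: h; rewrite //=.
  exact: realizes_put.
by rewrite /nvert /= size_put.
Qed.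

Lemma set_edge_refuted f g st u v b : realizes f g st ->
  u < nvert st -> v < nvert st -> u != v -> (f u -- f v) = b ->
  ~ refuted_all (set_edge u v b st).
Proof.
move=> R hu hv neq E; rewrite -[set_edge _ _ _ _]bind_id => h.
have [st' [R' _ _ [/(_ f g)]]] := set_edgeP R hu hv neq E h.
by move/(_ R').
Qed.

Lemma split_edge_sound st u v sts :
  split_edge u v st = Some sts -> refuted_all sts -> refuted st.
Proof.
rewrite /split_edge; case: ifP => // /and3P[hu hv neq] [<-].
move/refuted_all_cat => [h1 h0] f g R.
case E: (f u -- f v); first exact: (set_edge_refuted R hu hv neq E).
exact: (set_edge_refuted R hu hv neq E).
Qed.

Lemma realizes_close f g st v : realizes f g st -> v < nvert st ->
  (forall x, f v -- x -> exists2 u, u < nvert st & x = f u) ->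
  realizes f g (close v st).
Proof.
move=> R hv Hv.
have En w : (nth norow (rows (close v st)) w).2 = (nth norow (rows st) w).2.
  by rewrite nth_set_nth /=; case: eqP => [->|].
apply: realizes_rows (R) _ _ _.
- by rewrite size_set_nth; apply/maxn_idPr.
- move=> u w b hu hw E; apply: (real_entry R hu hw); move: E.
  by rewrite /entry !En.
move=> u x hu; rewrite nth_set_nth /=; case: eqP => [->|_] h; first exact: Hv.
exact: (real_shut R hu h).
Qed.

(** * Numbering a further vertex *)

Lemma mem_expand f g l x :
  (x \in expand f g l) = has (fun p => (x == f p.1) || (x \in g p.1)) l.
Proof.
elim: l => //= p l IH; rewrite /expand /= inE mem_cat -orbA; congr [|| _ , _ | _].
  exact: IH.
Qed.


Definition upd (T : Type) (h : nat -> T) n x := fun k => if k == n then x else h k.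

Lemma upd_id (T : Type) (h : nat -> T) n x : upd h n x n = x.
Proof. by rewrite /upd eqxx. Qed.

Lemma upd_other (T : Type) (h : nat -> T) n x k : k != n -> upd h n x k = h k.
Proof. by rewrite /upd => /negPf->. Qed.

Lemma eq_expand f f' g g' l :
  {in [seq p.1 | p <- l], f =1 f'} -> {in [seq p.1 | p <- l], g =1 g'} ->
  expand f g l = expand f' g' l.
Proof.
move=> Ef Eg; congr flatten; apply/eq_in_map => p pl.
by rewrite Ef ?Eg // map_f.
Qed.

Lemma expand_cat f g l1 l2 :
  expand f g (l1 ++ l2) = expand f g l1 ++ expand f g l2.
Proof. by rewrite /expand map_cat flatten_cat. Qed.

Lemma entry_fresh st u v : u < (nvert st).+1 -> v < (nvert st).+1 ->
  entry (rcons (rows st) (fresh_vrow st)) u v =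
  if (u < nvert st) && (v < nvert st) then entry (rows st) u v
  else if (u != v) && (shut st u || shut st v) then Some false else None.
Proof.
move=> hu hv; wlog le : u v hu hv / v <= u.
  move=> W; case: (leqP v u) => [|/ltnW] h; first exact: W.
  by rewrite entry_sym W // [entry (rows st) v u]entry_sym andbC orbC eq_sym.
rewrite /entry; have [lt|ge] := ltnP v u; last first.
  have -> : u = v by apply/eqP; rewrite eqn_leq ge le.
  by rewrite ltnn eqxx if_same.
rewrite (gtn_eqF lt) /= nth_rcons -/(nvert st).
have [ltu|geu] := ltnP u (nvert st); first by rewrite (ltn_trans lt).
have -> : u = nvert st by apply/eqP; rewrite eqn_leq geu -ltnS hu.
rewrite eqxx /=.
have ltv : v < nvert st by apply: leq_trans lt _; rewrite -ltnS.
have -> : shut st (nvert st) = false by rewrite /shut nth_default.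
by rewrite (nth_map norow).
Qed.

Section AddVertex.
Variables (f : nat -> G) (g : nat -> seq G) (st : state) (x : G).
Hypotheses (R : realizes f g st) (xf : forall u, u < nvert st -> x != f u).
Let n := nvert st.
Let f' := upd f n x.

Lemma upd_lt u : u < n -> f' u = f u.
Proof. by move=> h; rewrite /f' upd_other // ltn_eqF. Qed.

Lemma shut_new u : u < n -> shut st u -> (f u -- x) = false.
Proof.
move=> hu su; apply/negP => /(real_shut R hu su)[v hv E].
by have := xf hv; rewrite E eqxx.
Qed.

(** Common to new vertices on and off the cycle: the rows are dealt with here, and only the
    conditions on the cycle remain as premises. *)
Lemma realizes_add c' g' :
  stuck (expand f' g' c') ->
  (forall p, p \in c' -> ~~ p.2 -> g' p.1 = [::]) ->
  (forall u, u <= n -> (f' u \in expand f' g' c') = (u \in [seq p.1 | p <- c'])) ->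
  (forall u, u \in [seq p.1 | p <- c'] -> u <= n) ->
  realizes f' g' (State (rcons (rows st) (fresh_vrow st)) c').
Proof.
have nvE : nvert (State (rcons (rows st) (fresh_vrow st)) c') = n.+1.
  by rewrite /nvert size_rcons.
move=> H1 H2 H3 H4; split=> //; rewrite nvE //.
- move=> u v; rewrite !ltnS leq_eqVlt [v <= n]leq_eqVlt.
  case/predU1P=> [->|hu] /predU1P[->|hv] //; last first.
  + by rewrite !upd_lt //; apply: real_inj R _ _ hu hv.
  + by rewrite upd_lt // /f' upd_id => E; have := xf hu; rewrite E eqxx.
  by rewrite [f' v]upd_lt // /f' upd_id => E; have := xf hv; rewrite E eqxx.
- move=> u v b hu hv; rewrite entry_fresh //.
  have [ltu|geu] /= := ltnP u n.
    have [ltv|gev] /= := ltnP v n.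
      by rewrite !upd_lt //; apply: real_entry R _ _ _ ltu ltv.
    have Ev : v = n by apply/eqP; rewrite eqn_leq -ltnS hv gev.
    rewrite Ev (ltn_eqF ltu) upd_lt // /f' upd_id.
    have -> : shut st n = false by rewrite /shut nth_default.
    by rewrite orbF; case: ifP => // h [<-]; apply: shut_new.
  have -> : u = n by apply/eqP; rewrite eqn_leq -ltnS hu geu.
  have -> : shut st n = false by rewrite /shut nth_default.
  rewrite /f' upd_id; case: ifP => // /andP[neq h] [<-].
  have ltv : v < n by rewrite ltn_neqAle eq_sym neq -ltnS.
  by rewrite -/f' upd_lt // adj_sym; apply: shut_new.
- move=> u y hu; rewrite /shut nth_rcons -/(nvert st) -/n.
  case: ltnP => [ltu su|_]; last by case: ifP.
  rewrite upd_lt // => /(real_shut R ltu su)[v hv ->].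
  by exists v; rewrite ?upd_lt // ltnS ltnW.
Qed.

Lemma new_notin_cyc : n \notin on_cyc st.
Proof. by apply/negP => /(real_lt R); rewrite ltnn. Qed.

Lemma realizes_add_off : x \notin expand f g (cyc st) -> realizes f' g (add_off st).
Proof.
move=> xc; have E : expand f' g (cyc st) = expand f g (cyc st).
  by apply: eq_expand => // u /(real_lt R); apply: upd_lt.
apply: realizes_add; rewrite ?E; first exact: real_stuck R.
- exact: real_seg R.
- move=> u; rewrite leq_eqVlt => /predU1P[->|h].
    by rewrite {1}/f' upd_id (negPf xc) (negPf new_notin_cyc).
  by rewrite upd_lt //; apply: real_on R _ h.
by move=> u /(real_lt R)/ltnW.
Qed.

(** A repeated number would repeat a vertex of the expanded cycle. *)
Lemma uniq_on_cyc : uniq (on_cyc st).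
Proof.
have [/andP[_ /andP[_ U]] _] := real_stuck R.
move: U (real_lt R); rewrite /on_cyc /expand; elim: (cyc st) => //= p l IH.
rewrite mem_cat cat_uniq => /andP[pn /and3P[_ _ U]] lt.
rewrite IH // ?andbT; last by move=> u h; apply: lt; rewrite inE h orbT.
apply: contra pn => /mapP[q ql E]; rewrite orbC; apply/orP; left.
by apply/flattenP; exists (f q.1 :: g q.1); rewrite ?E ?mem_head ?map_f //;
  apply/mapP; exists q.
Qed.

Lemma mem_cyc_insert u b1 w b2 l v : u \in [seq p.1 | p <- l] ->
  (v \in [seq p.1 | p <- cyc_insert u b1 w b2 l]) = (v == w) || (v \in [seq p.1 | p <- l]).
Proof.
elim: l => //= p l IH; rewrite inE eq_sym; case: eqP => [->|_] /=.
  by rewrite !inE orbCA.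
by move=> /IH E; rewrite !inE E orbCA.
Qed.

(** The segment after [u] is cut at [x]: the part [s1] stays with [u], and [s2] follows the new
    number [w]. *)
Lemma expand_insert u b1 w b2 l s1 s2 :
  uniq [seq p.1 | p <- l] -> u \in [seq p.1 | p <- l] ->
  w \notin [seq p.1 | p <- l] -> g u = s1 ++ x :: s2 ->
  expand (upd f w x) (upd (upd g u s1) w s2) (cyc_insert u b1 w b2 l)
    = expand f g l.
Proof.
move=> U ul wl Eg; elim: l U ul wl => //= p l IH /andP[pl U].
rewrite !inE negb_or eq_sym => h /andP[wp wl].
have [E|neq] /= := eqVneq p.1 u.
  subst u; have wp' : p.1 != w by rewrite eq_sym.
  rewrite /expand /= (upd_other f _ wp') (upd_other _ _ wp') !upd_id Eg.
  rewrite -catA /=; congr (_ :: _ ++ _ :: _ ++ _); apply: eq_expand => v vl.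
    by rewrite upd_other //; apply: contraNneq wl => <-.
  rewrite !upd_other //; last by apply: contraNneq wl => <-.
  by apply: contraNneq pl => <-.
move: h; rewrite (negPf neq) /= => ul.
rewrite /expand /= -!/(expand _ _ _) IH //.
by rewrite !upd_other // eq_sym.
Qed.

(** [add_new] sets both flags. [next_gap] cuts at an end of the segment, where one part is empty and
    its flag may be off. *)
Lemma realizes_add_on u b1 b2 s1 s2 : (u, true) \in cyc st ->
  g u = s1 ++ x :: s2 -> b1 || nilp s1 -> b2 || nilp s2 ->
  realizes f' (upd (upd g u s1) n s2) (add_on u b1 b2 st).
Proof.
move=> uc Eg h1 h2.
have ul : u \in on_cyc st by apply/mapP; exists (u, true).
have ltu := real_lt R ul.
have E : expand f' (upd (upd g u s1) n s2) (cyc_insert u b1 n b2 (cyc st))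
         = expand f g (cyc st).
  by apply: expand_insert => //; [apply: uniq_on_cyc | apply: new_notin_cyc].
apply: realizes_add; rewrite ?E; first exact: real_stuck R.
- move=> p; have := new_notin_cyc; have := uniq_on_cyc; rewrite /on_cyc.
  have := @real_seg _ _ _ R.
  elim: (cyc st) ul => //= q l IH; rewrite inE eq_sym.
  have [Eq|neq] /= := eqVneq q.1 u => ul Hs /andP[ql U]; rewrite inE negb_or.
    case/andP=> nq nl; rewrite !inE => /or3P[/eqP->|/eqP->|pl] //=.
    + by rewrite upd_other ?upd_id ?(ltn_eqF ltu) // => /negPf e; move: h1; rewrite e => /nilP.
    + by rewrite upd_id => /negPf e; move: h2; rewrite e => /nilP.
    have pm : p.1 \in [seq p.1 | p <- l] by rewrite map_f.
    move=> np; rewrite !upd_other; first by apply: Hs; rewrite // inE pl orbT.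
      by apply: contraNneq ql => e; rewrite Eq -e.
    by apply: contraNneq nl => <-.
  case/andP=> nq nl => /predU1P[->|pl] np.
    by rewrite !upd_other //; apply: Hs np; apply: mem_head.
  by apply: IH => // r rl; apply: Hs; rewrite inE rl orbT.
- move=> v; rewrite mem_cyc_insert // leq_eqVlt => /predU1P[->|h].
    rewrite {1}/f' upd_id eqxx /= mem_expand; apply/hasP; exists (u, true) => //=.
    by rewrite Eg mem_cat mem_head !orbT.
  by rewrite upd_lt // (ltn_eqF h) /=; apply: real_on R _ h.
by move=> v; rewrite mem_cyc_insert // => /predU1P[->//|/(real_lt R)/ltnW].
Qed.

End AddVertex.

Lemma bind_cons (T : Type) (x : T) s k : bind (x :: s) k = k x ++ bind s k.
Proof. by []. Qed.

Lemma bind_map (T U : Type) (h : T -> U) s k : bind (map h s) k = bind s (k \o h).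
Proof. by rewrite /bind -map_comp. Qed.

Lemma add_newP f g st x k : realizes f g st ->
  (forall u, u < nvert st -> x != f u) ->
  refuted_all (bind (add_new st) k) ->
  exists f' g' st', [/\ realizes f' g' st', nvert st' = (nvert st).+1,
    f' (nvert st) = x, forall u, u < nvert st -> f' u = f u
    & refuted_all (k st')].
Proof.
move=> R xf; rewrite /add_new bind_cons => /refuted_all_cat[h0 h1].
have upd_f u : u < nvert st -> upd f (nvert st) x u = f u.
  by move=> hu; rewrite upd_other // ltn_eqF.
have [|xc] := boolP (x \in expand f g (cyc st)); last first.
  exists (upd f (nvert st) x), g, (add_off st).
  split=> //; first exact: realizes_add_off.
    by rewrite /nvert size_rcons.
  exact: upd_id.
rewrite mem_expand => /hasP[p pc /orP[/eqP E|xg]].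
  have hp : p.1 < nvert st by apply: (real_lt R); apply: map_f.
  by have := xf _ hp; rewrite E eqxx.
(* A direct link has an empty segment, so [x] lies in a gap and the matching case occurs in
   [add_new]. *)
have p2 : p.2.
  by apply: contraT => /(real_seg R pc) E; rewrite E in xg.
have [s1 [s2 Eg]] : exists s1 s2, g p.1 = s1 ++ x :: s2.
  by case/splitPr: xg => s1 s2; exists s1, s2.
move: h1; rewrite bind_map => h1.
have pf : p \in [seq p <- cyc st | p.2] by rewrite mem_filter p2.
move/refuted_bind: h1 => /(_ _ pf) h1.
have pc' : (p.1, true) \in cyc st by rewrite -p2 -surjective_pairing.
exists (upd f (nvert st) x), (upd (upd g p.1 s1) (nvert st) s2).
exists (add_on p.1 true true st); split.
- exact: realizes_add_on Eg _ _.
- by rewrite /nvert size_rcons.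
- exact: upd_id.
- exact: upd_f.
- exact: h1.
Qed.

Lemma new_nbr_sound st v sts :
  new_nbr v st = Some sts -> refuted_all sts -> refuted st.
Proof.
rewrite /new_nbr; case: ifP => // hv [<-] [hc hn] f g R.
have [/forallP H|] := boolP [forall x, (f v -- x) ==> (x \in map f (named st))].
  apply: (hc f g); apply: realizes_close => // x vx.
  have /mapP[u] := implyP (H x) vx.
  by rewrite mem_iota => hu ->; exists u.
rewrite negb_forall => /existsP[x]; rewrite negb_imply => /andP[vx xn].
have xf u : u < nvert st -> x != f u.
  by move=> hu; apply: contraNneq xn => ->; rewrite map_f // mem_iota.
have [f' [g' [st' [R' E1 E2 E3]]]] := add_newP R xf hn.
apply: (set_edge_refuted R'); rewrite ?E1 ?ltnS ?leqnn //.
- exact: ltnW.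
- by rewrite ltn_eqF.
by rewrite E2 E3.
Qed.

(** * Links and gaps of the cycle *)

Lemma expand_rot f g i l : exists j, expand f g (rot i l) = rot j (expand f g l).
Proof.
exists (size (expand f g (take i l))).
by rewrite -{3}[l](cat_take_drop i) expand_cat rot_size_cat /rot expand_cat.
Qed.

(** After rotating the cycle to start at [p], the segment of [p] and the next numbered vertex stand
    at the front; if [p] is the only entry, that vertex is [p] again. *)
Lemma linkP f g st p : realizes f g st -> p \in cyc st ->
  path adj (f p.1) (rcons (g p.1) (f (next (on_cyc st) p.1))).
Proof.
move=> R pc; have U := uniq_on_cyc R.
have [/andP[_ /andP[C _]] _] := real_stuck R.
have [i l El] := rot_to pc.
have [j Ej] := expand_rot f g i (cyc st).
move: C; rewrite -(rot_cycle j) -Ej -(next_rot i) // /on_cyc -map_rot El /=.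
case: l {El Ej} => [|q l] /=; rewrite eqxx /expand /=; first by rewrite cats0.
by rewrite rcons_cat cat_path => /and3P[a b _]; rewrite rcons_path a b.
Qed.

(** If [x] had a number, it would occur twice on the cycle, once as a numbered vertex and once
    inside a segment. *)
Lemma seg_new f g st p x u : realizes f g st -> p \in cyc st -> x \in g p.1 ->
  u < nvert st -> x != f u.
Proof.
move=> R pc xg hu; apply/eqP => E; rewrite {x}E in xg.
have : f u \in expand f g (cyc st).
  by rewrite mem_expand; apply/hasP; exists p; rewrite ?xg ?orbT.
rewrite (real_on R hu) /on_cyc => uc.
have [/andP[_ /andP[_ U]] _] := real_stuck R.
elim: (cyc st) uc pc U => //= q l IH; rewrite !inE /expand /= mem_cat cat_uniq.
have xl : p \in l -> f u \in expand f g l.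
  by move=> pl; rewrite mem_expand; apply/hasP; exists p; rewrite ?xg ?orbT.
case/predU1P=> [Eu|ul] /predU1P[pq|pl] /andP[nq /and3P[_ nl Ul]].
- by move: nq; rewrite -Eu; move: xg; rewrite pq -Eu => ->.
- by move: nq; rewrite -Eu negb_or => /andP[_ /negP[]]; apply: xl.
- case/negP: nl; apply/hasP; exists (f u); last by rewrite -pq.
  have /mapP[r rl ->] := ul.
  by change (f r.1 \in expand f g l); rewrite mem_expand; apply/hasP; exists r; rewrite ?eqxx.
exact: IH.
Qed.

Lemma realizes_direct f g st u : realizes f g st -> g u = [::] ->
  realizes f g (cyc_direct u st).
Proof.
move=> R Eg; have Eo : on_cyc (cyc_direct u st) = on_cyc st.
  by rewrite /on_cyc /= -map_comp; apply: eq_map => p.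
have Ee : expand f g (cyc (cyc_direct u st)) = expand f g (cyc st).
  by rewrite /expand /= -map_comp; congr flatten; apply: eq_map => p.
case: R => r1 r2 r3 r4 r5 r6 r7; split; rewrite ?Eo ?Ee //.
by move=> _ /mapP[p pc ->] /=; case: eqP => [->|_] // h; exact: r5.
Qed.

Lemma next_gap_sound st b u sts :
  next_gap b u st = Some sts -> refuted_all sts -> refuted st.
Proof.
rewrite /next_gap; case: ifP => // /andP[uc uv] [<-] /refuted_all_cat[h1 h2] f g R.
have uo : u \in on_cyc st by apply/mapP; exists (u, true).
have vo : next (on_cyc st) u \in on_cyc st by rewrite mem_next.
have hu := real_lt R uo; have hv := real_lt R vo.
have L := linkP R uc; rewrite /= in L.
(* An empty segment makes the link an edge. Otherwise its first or last vertex is the one that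
   receives a number. *)
case Eg: (g u) => [|y s].
  apply: (set_edge_refuted (realizes_direct R Eg)) h1 => //.
  by move: L; rewrite Eg /= andbT.
have ltn1 c1 c2 : nvert (add_on u c1 c2 st) = (nvert st).+1.
  by rewrite /nvert size_rcons.
have lt1 w c1 c2 : w <= nvert st -> w < nvert (add_on u c1 c2 st) by rewrite ltn1.
case: b h2 => /= h2.
  have xf w : w < nvert st -> y != f w.
    by apply: (seg_new R uc); rewrite /= Eg mem_head.
  have R' := realizes_add_on R xf uc (s1 := [::]) Eg (b1 := false) (b2 := true) isT isT.
  have E : upd f (nvert st) y u -- upd f (nvert st) y (nvert st).
    by rewrite upd_lt // upd_id; move: L; rewrite Eg /= => /andP[].
  exact: set_edge_refuted R' (lt1 _ _ _ (ltnW hu)) (lt1 _ _ _ (leqnn _)) (negbT (ltn_eqF hu)) E h2.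
have [s' [x Es]] : exists s' x, g u = rcons s' x.
  by rewrite Eg; case/lastP: s {Eg} => [|s x]; [exists [::], y | exists (y :: s), x].
have xf w : w < nvert st -> x != f w.
  by apply: (seg_new R uc); rewrite /= Es mem_rcons mem_head.
have E : x -- f (next (on_cyc st) u).
  by move: L; rewrite Es rcons_path last_rcons => /andP[].
rewrite -cats1 in Es.
have R' := realizes_add_on R xf uc Es (b1 := true) (b2 := false) isT isT.
have E' : upd f (nvert st) x (next (on_cyc st) u) -- upd f (nvert st) x (nvert st).
  by rewrite upd_lt // upd_id adj_sym.
exact: set_edge_refuted R' (lt1 _ _ _ (ltnW hv)) (lt1 _ _ _ (leqnn _)) (negbT (ltn_eqF hv)) E' h2.
Qed.

(** * Degree bound and local connectivity *)

Hypothesis Gdeg : forall v : G, degree v <= 6.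
Hypothesis Glconn : locally_connected G.

(** Otherwise the neighbours of [v] in [A] would be closed under adjacency within the neighbourhood,
    against its connectivity. *)
Lemma local_edge (v a b : G) (A : {pred G}) :
  v -- a -> a \in A -> v -- b -> b \notin A ->
  exists a' b', [/\ v -- a', a' \in A, v -- b', b' \notin A & a' -- b'].
Proof.
move=> va aA vb bA.
have [/existsP[a' /existsP[b' /and5P[*]]]|none] := boolP
  [exists a', exists b', [&& v -- a', a' \in A, v -- b', b' \notin A & a' -- b']].
  by exists a', b'.
have [va' vb'] : a \in nbhd v /\ b \in nbhd v by rewrite !inE.
pose X := [pred y : induced (nbhd v) | val y \in A].
have X_closed : closed (@adj (induced (nbhd v))) X.
  apply: intro_closed; first by apply: sym_connect_sym; exact: adj_sym.
  move=> y z yz yX; apply: contraR none => zX.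
  apply/existsP; exists (val y); apply/existsP; exists (val z).
  have := valP y; have := valP z; rewrite !inE => vz vy.
  by apply/and5P; split.
have := closed_connect X_closed (Glconn (exist _ a va') (exist _ b vb')).
by rewrite !inE /= aA (negPf bA).
Qed.

Lemma known_nbrs f g st v : realizes f g st -> v < nvert st ->
  let ys := [seq u <- named st | known true st v u] in
  uniq (map f ys) /\ {subset map f ys <= nbhd (f v)}.
Proof.
move=> R hv; split.
  rewrite map_inj_in_uniq ?filter_uniq ?iota_uniq // => u w.
  rewrite !mem_filter !mem_iota /= add0n => /andP[_ hu] /andP[_ hw].
  exact: real_inj R _ _ hu hw.
move=> _ /mapP[u + ->]; rewrite mem_filter mem_iota => /andP[h hu].
by rewrite inE (knownP R hv hu h).
Qed.

Lemma realizes_fill f g st v : realizes f g st -> v < nvert st ->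
  (forall u, u < nvert st -> f v -- f u -> known true st v u) ->
  realizes f g (fill_nonnbrs v st) /\ nvert (fill_nonnbrs v st) = nvert st.
Proof.
move=> R hv H; rewrite /fill_nonnbrs; set F := fun s u => _.
have IHl l s : {subset l <= named st} -> realizes f g s -> nvert s = nvert st ->
    realizes f g (foldl F s l) /\ nvert (foldl F s l) = nvert st.
  elim: l s => //= u l IH s sub Rs Es.
  have hu : u < nvert st by have := sub u (mem_head _ _); rewrite mem_iota.
  apply: IH => [w wl||]; first by apply: sub; rewrite inE wl orbT.
    rewrite /F; case: ifP => // /andP[uv nk].
    apply: realizes_put; rewrite ?Es 1?eq_sym //.
    by apply: contraNF nk; apply: H.
  by rewrite /F; case: ifP => // _; rewrite /nvert size_put -/(nvert s) ?Es.
exact: IHl.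
Qed.

Lemma close_full_sound st v sts :
  close_full v st = Some sts -> refuted_all sts -> refuted st.
Proof.
rewrite /close_full -size_filter; set ys := [seq u <- _ | _].
case: ltnP => [gt6 _ _ f g R|_].
  have hv : v < nvert st.
    (* An unnumbered [v] has the default row, hence no known neighbours. *)
    case: ltnP => // ge; move: gt6; rewrite /ys (eq_in_filter (a2 := pred0)) ?filter_pred0 //.
    move=> u; rewrite mem_iota /= => hu; rewrite /known /entry (leq_trans hu ge).
    by rewrite (nth_default norow ge) nth_nil.
  have [U S] := known_nbrs R hv.
  have := Gdeg (f v); rewrite leqNgt => /negP[]; apply: leq_trans gt6 _.
  by rewrite -(size_map f) -(card_uniqP U); apply/subset_leq_card/subsetP.
case: ifP => // /andP[/eqP d6 hv] [<-] [h _] f g R.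
have [U S] := known_nbrs R hv.
(* By the degree bound, six distinct neighbours exhaust the neighbourhood. *)
have Enb : nbhd (f v) =i map f ys.
  apply/fsym/subset_cardP; last exact/subsetP.
  apply/eqP; rewrite eqn_leq subset_leq_card; last exact/subsetP.
  by rewrite (card_uniqP U) size_map d6 Gdeg.
have H x : f v -- x -> exists2 u, u \in ys & x = f u.
  by move=> vx; have := Enb x; rewrite inE vx => /esym/mapP[u]; exists u.
have [|R' E] := realizes_fill R hv.
  move=> u hu /H[w]; rewrite mem_filter mem_iota add0n => /andP[hk hw].
  by move/(real_inj R hu hw) => ->.
apply: (h f g); apply: realizes_close; rewrite ?E // => x /H[u + ->].
by rewrite mem_filter mem_iota => /andP[_ hu]; exists u.
Qed.

Lemma connect_nbrs_sound st v K sts :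
  connect_nbrs v K st = Some sts -> refuted_all sts -> refuted st.
Proof.
rewrite /connect_nbrs; set out := [seq b <- _ | _].
case: ifP => // /and5P[hv vK /allP hK /hasP[a0 a0K ka0] /hasP[b0 + kb0]] [<-] h f g R.
rewrite mem_filter mem_iota => /andP[b0K hb0].
have fK u : u < nvert st -> (f u \in map f K) = (u \in K).
  move=> hu; apply/mapP/idP => [[w wK /(real_inj R hu (hK _ wK))->] //|uK].
  by exists u.
(* An edge of the neighbourhood leaves the image of [K]. Its outer end [b] is numbered or new, which
   gives the two kinds of cases. *)
have [a [b [va aA vb bA ab]]] := @local_edge (f v) (f a0) (f b0) [in map f K]
  (knownP R hv (hK _ a0K) ka0) (map_f f a0K) (knownP R hv hb0 kb0) (etrans (congr1 negb (fK _ hb0)) b0K).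
have /mapP[u uK Ea] := aA; subst a; have hu := hK _ uK.
have uv : v != u by apply: contraNneq vK => ->.
have /(set_edgeP R hv hu uv va)[s1 [R1 E1 _]] := refuted_bind h uK.
case/refuted_all_cat=> h1 h2.
have [/mapP[w + Eb]|bn] := boolP (b \in map f (named st)).
  rewrite mem_iota => hw; subst b; rewrite fK // in bA.
  have wv : w != v by apply: contraTneq vb => ->; rewrite adj_irr.
  have wout : w \in [seq b <- out | b != v] by rewrite !mem_filter wv bA mem_iota.
  rewrite -E1 in hv hu hw.
  have /(set_edgeP R1 hv hw _ vb)[|s2 [R2 E2 _]] := refuted_bind h1 wout.
    by rewrite eq_sym.
  rewrite -E2 in hv hu hw.
  by apply: (set_edge_refuted R2 hu hw) ab; apply: contraNneq bA => <-.
have bf w : w < nvert s1 -> b != f w.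
  by rewrite E1 => hw; apply: contraNneq bn => ->; rewrite map_f // mem_iota.
have [f' [g' [s2 [R2 E2 E3 E4]]]] := add_newP R1 bf h2.
rewrite E1 in E2 E3 E4.
have hv' : v < nvert s2 by rewrite E2 ltnS ltnW.
have hn' : nvert st < nvert s2 by rewrite E2.
case/(set_edgeP R2 hv' hn'); rewrite ?ltn_eqF ?E3 ?E4 // => s3 [R3 E5 _].
by apply: (set_edge_refuted R3); rewrite ?E5 ?E2 ?ltnS ?leqnn ?ltn_eqF ?E3 ?E4 // ltnW.
Qed.

(** * Reversing and lengthening the cycle *)

(** Extendability depends on a cycle only through its vertex set. *)
Lemma stuck_eq (c c' : seq G) : is_cycle c' -> c' =i c -> stuck c -> stuck c'.
Proof.
move=> C' E [_ N]; split=> // -[y [d [yc Cd Ed]]]; apply: N.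
exists y, d; split=> //; first by rewrite -E.
by move=> x; rewrite Ed !inE E.
Qed.

Lemma is_cycle_rot i (c : seq G) : is_cycle (rot i c) = is_cycle c.
Proof. by rewrite /is_cycle /ucycleb size_rot rot_cycle rot_uniq. Qed.

Lemma is_cycle_rev (c : seq G) : is_cycle (rev c) = is_cycle c.
Proof.
rewrite /is_cycle /ucycleb size_rev rev_cycle rev_uniq; congr [&& _, _ & _].
by apply: eq_cycle => x y; rewrite adj_sym.
Qed.

Lemma map_rev_links b l :
  [seq p.1 | p <- rev_links b l] = rev [seq p.1 | p <- l].
Proof. by elim: l b => //= p l IH b; rewrite map_rcons IH rev_cons. Qed.

(** By the path hypothesis [prev xs] of an entry is the entry before it, [u0] for the first one.
    Reversal thus attaches to each vertex the reversed segment of its predecessor. *)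
Lemma rev_expand f g xs u0 b0 l :
  path (fun x y => x == prev xs y) u0 [seq p.1 | p <- l] ->
  rev (g u0 ++ expand f g l) =
  rev (g (last u0 [seq p.1 | p <- l])) ++
  expand f (fun u => rev (g (prev xs u))) (rev_links b0 l).
Proof.
elim: l u0 b0 => [|p l IH] u0 b0 /=; first by rewrite !cats0.
case/andP=> /eqP Eu /(IH _ p.2) E.
rewrite -cats1 expand_cat catA -E.
by rewrite {1}/expand /= rev_cat rev_cons cat_rcons /expand /= cats0 -Eu.
Qed.

Lemma rev_links_seg g xs u0 b0 l :
  path (fun x y => x == prev xs y) u0 [seq p.1 | p <- l] ->
  (~~ b0 -> g u0 = [::]) -> (forall p, p \in l -> ~~ p.2 -> g p.1 = [::]) ->
  forall p, p \in rev_links b0 l -> ~~ p.2 -> rev (g (prev xs p.1)) = [::].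
Proof.
elim: l u0 b0 => //= q l IH u0 b0 /andP[/eqP Eu Pl] H0 Hl p.
rewrite mem_rcons inE => /predU1P[->|]; first by rewrite /= -Eu => /H0->.
by apply: IH Pl _ _ p => [|r rl]; apply: Hl; rewrite inE ?eqxx ?rl ?orbT.
Qed.

Lemma reverse_sound st : refuted (reverse st) -> refuted st.
Proof.
move=> h f g R; have U := uniq_on_cyc R.
have [p pc] : exists p, p \in cyc st.
  have [/andP[+ _] _] := real_stuck R.
  by case: (cyc st) => // p l _; exists p; rewrite mem_head.
pose xs := on_cyc st; pose g' u := rev (g (prev xs u)).
pose u0 := last 0 xs; pose b0 := last false [seq p.2 | p <- cyc st].
have P0 : path (fun x y => x == prev xs y) u0 [seq p.1 | p <- cyc st].
  by have := cycle_prev U; rewrite (cycle_path 0).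
(* Plain reversal puts the segment of the last numbered vertex first, whereas the reversed state
   puts it last; a rotation by its length relates the two. *)
have [j Ej] : exists j, expand f g' (cyc (reverse st)) = rot j (rev (expand f g (cyc st))).
  exists (size (rev (g u0))).
  have := rev_expand f g b0 P0; rewrite rev_cat.
  have -> : last u0 [seq p.1 | p <- cyc st] = u0.
    by rewrite /u0 /xs /on_cyc; case: (cyc st) pc.
  set X := expand f _ _ => E.
  pose Y := drop (size (rev (g u0))) (rev (expand f g (cyc st))).
  have le : size (rev (g u0)) <= size (rev (expand f g (cyc st))).
    rewrite !size_rev /u0 /xs /on_cyc; case/lastP: (cyc st) pc => // l q _.
    rewrite map_rcons last_rcons -cats1 expand_cat size_cat /expand /= cats0.
    by rewrite (leq_trans (leqnSn _)) // leq_addl.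
  have E1 : rev (expand f g (cyc st)) = rev (g u0) ++ Y.
    have Et := congr1 (take (size (rev (g u0)))) E.
    move: Et; rewrite takel_cat // take_size_cat // => Et.
    by rewrite /Y -[X in X ++ _]Et cat_take_drop.
  move: E; rewrite E1 rot_size_cat -catA.
  by move/eqP; rewrite eqseq_cat // => /andP[_ /eqP<-].
have Eo : on_cyc (reverse st) = rev (on_cyc st) by rewrite /on_cyc map_rev_links.
have Em : expand f g' (cyc (reverse st)) =i expand f g (cyc st).
  by move=> x; rewrite Ej mem_rot mem_rev.
apply: (h f g'); split.
- exact: real_inj R.
- exact: real_entry R.
- exact: real_shut R.
- apply: stuck_eq Em (real_stuck R); rewrite Ej is_cycle_rot is_cycle_rev.
  by case: (real_stuck R).
- apply: rev_links_seg P0 _ (real_seg R) => /negPf hb.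
  rewrite /u0 /xs /on_cyc; move: hb (real_seg R) pc; rewrite /b0.
  case/lastP: (cyc st) => // l q; rewrite !map_rcons !last_rcons => hb Hs _.
  by apply: Hs; rewrite ?hb // mem_rcons mem_head.
- by move=> u hu; rewrite Em (real_on R hu) Eo mem_rev.
by move=> u; rewrite Eo mem_rev => /(real_lt R).
Qed.

(** Numbered and unnumbered vertices are separated so that each kind can be matched on its own when
    the longer cycle is compared with the old one. *)
Lemma perm_expand f g l :
  perm_eq (expand f g l) ([seq f p.1 | p <- l] ++ flatten [seq g p.1 | p <- l]).
Proof.
elim: l => //= p l IH; rewrite /expand /= perm_cons.
by rewrite perm_sym perm_catCA perm_cat2l perm_sym.
Qed.

Section NewCycle.
Variables (f : nat -> G) (seg : nat * nat -> seq G).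

(** The paths along consecutive links join to one walk; with [b] equal to [a] it closes up. *)
Lemma path_links a s b :
  all (fun q => path adj (f q.1) (rcons (seg q) (f q.2))) (zip (a :: s) (rcons s b)) ->
  exists2 t, flatten [seq f q.1 :: seg q | q <- zip (a :: s) (rcons s b)] = f a :: t
    & path adj (f a) (rcons t (f b)).
Proof.
elim: s a => [|c s IH] a /=; first by rewrite andbT cats0; exists (seg (a, b)).
case/andP=> Pac /IH[t E Pt]; exists (rcons (seg (a, c)) (f c) ++ t).
  by rewrite E cat_rcons.
by rewrite rcons_cat cat_path last_rcons Pac.
Qed.

Lemma perm_links (l : seq (nat * nat)) :
  perm_eq (flatten [seq f q.1 :: seg q | q <- l])
          ([seq f q.1 | q <- l] ++ flatten [seq seg q | q <- l]).
Proof.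
elim: l => //= p l IH; rewrite perm_cons.
by rewrite perm_sym perm_catCA perm_cat2l perm_sym.
Qed.
End NewCycle.

Lemma extends_sound st p : extends p st -> refuted st.
Proof.
case: p => // y ws; rewrite /extends; set gs := gaps st; set links := zip _ _.
set used := flatten _ => /and5P[sz hy yc /allP hws /and4P[sws /allP hl /allP hus sus]] f g R.
(* A gap is traversed forwards or backwards; any other link is a single edge. *)
pose seg (q : nat * nat) :=
  if q \in gs then g q.1 else if (q.2, q.1) \in gs then rev (g q.2) else [::].
pose c := expand f g (cyc st).
pose c' := flatten [seq f q.1 :: seg q | q <- links].
have U := uniq_on_cyc R.
have gsP q : q \in gs -> path adj (f q.1) (rcons (g q.1) (f q.2)).
  case/mapP=> p; rewrite mem_filter => /andP[_ pc] ->.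
  exact: linkP R pc.
(* [ws] contains all numbered vertices of the cycle and is no longer than their list, so it has each
   exactly once. *)
have pws : perm_eq (on_cyc st) ws.
  have sw : size ws <= size (on_cyc st) by rewrite size_map.
  apply: uniq_perm => //; first exact: leq_size_uniq U hws sw.
  exact: (uniq_min_size U hws sw).2.
have lt_links q : q \in links -> q.1 < nvert st /\ q.2 < nvert st.
  have lt u : u \in y :: ws -> u < nvert st.
    by rewrite inE => /predU1P[->//|]; rewrite -(perm_mem pws) => /(real_lt R).
  move=> ql; split; apply: lt.
    by rewrite -[y :: ws](@unzip1_zip _ _ _ (rcons ws y)) ?size_rcons // map_f.
  rewrite -mem_rcons -[rcons ws y](@unzip2_zip _ _ (y :: ws)) ?size_rcons //.
  exact: map_f.
have : all (fun q => path adj (f q.1) (rcons (seg q) (f q.2))) links.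
  apply/allP => q ql; have [h1 h2] := lt_links q ql.
  rewrite /seg; case: ifP => [/gsP//|n1]; case: ifP => [/gsP /= P|n2].
    rewrite -rev_cons -(last_rcons (f q.2) (g q.2) (f q.1)).
    rewrite -[X in rev X](belast_rcons (f q.2) (g q.2) (f q.1)) rev_path.
    by rewrite (eq_path (e' := adj)) // => u v; rewrite adj_sym.
  by have := hl q ql; rewrite n1 n2 /= andbT => /(knownP R h1 h2).
case/path_links=> t Et Pt.
have perm_used : perm_eq (flatten [seq seg q | q <- links]) (flatten [seq g u | u <- used]).
  rewrite /used; elim: (links) => //= q l IH; rewrite map_cat flatten_cat.
  apply: perm_cat IH; rewrite /seg /used_gaps.
  case: ifP => _ /=; first by rewrite cats0.
  by case: ifP => _ //=; rewrite cats0 perm_rev.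
(* The same counting shows that every gap is traversed exactly once. *)
have perm_gs : perm_eq [seq q.1 | q <- gs] used.
  have Ug : uniq [seq q.1 | q <- gs].
    rewrite /gs /gaps -map_comp; apply: subseq_uniq U.
    by apply: map_subseq; apply: filter_subseq.
  have sub : {subset [seq q.1 | q <- gs] <= used} by move=> _ /mapP[q qg ->]; apply: hus.
  have su : size used <= size [seq q.1 | q <- gs] by rewrite size_map.
  apply: uniq_perm => //; first exact: leq_size_uniq Ug sub su.
  exact: (uniq_min_size Ug sub su).2.
have Eg : flatten [seq g p.1 | p <- cyc st] = flatten [seq g u | u <- [seq q.1 | q <- gs]].
  rewrite /gs /gaps -!map_comp /comp /=.
  have := @real_seg _ _ _ R; elim: (cyc st) => //= q l IH H.
  have Hl r : r \in l -> ~~ r.2 -> g r.1 = [::].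
    by move=> rl; apply: H; rewrite inE rl orbT.
  by rewrite (IH Hl); case: ifP => q2 //=; rewrite H ?mem_head ?q2.
(* Hence the closed walk visits [f y] and each vertex of the old cycle exactly once. *)
have P : perm_eq c' (f y :: c).
  apply: perm_trans (perm_links _ _ _) _.
  have -> : [seq f q.1 | q <- links] = map f (y :: ws).
    by rewrite (map_comp f fst) [map fst _]unzip1_zip // size_rcons.
  rewrite /= perm_cons perm_sym; apply: perm_trans (perm_expand _ _ _) _.
  apply: perm_cat; first by rewrite (map_comp f fst); apply: perm_map.
  rewrite Eg perm_sym; apply: perm_trans perm_used _.
  by apply: perm_flatten; apply: perm_map; rewrite perm_sym.
have [/andP[_ /andP[_ Uc]] N] := real_stuck R; apply: N.
have nyc : f y \notin c by rewrite (real_on R hy).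
exists (f y), c'; split=> //; last exact: perm_mem.
have sz' : 2 < size c'.
  rewrite (perm_size P) /= ltnS; apply: (leq_trans (n := size ws)) => //.
  rewrite (perm_size (perm_expand f g (cyc st))) size_cat size_map.
  exact: leq_trans sws (leq_addr _ _).
rewrite /is_cycle /ucycleb sz' (perm_uniq P) /= nyc Uc andbT.
by rewrite /c' Et /= Pt.
Qed.

(** * Clustering, excluded patterns and small graphs *)

Hypothesis Gsparse : forall (v : G) (s : seq G), uniq s -> {subset s <= nbhd v} ->
  1 < degree v /\ nonadj_pairs (fun x y => ~~ (x -- y)) s <= 'C(degree v, 2)./2.

Lemma nonadj_pairs_map f g st s : realizes f g st -> all (gtn (nvert st)) s ->
  nonadj_pairs (known false st) s <=
  nonadj_pairs (fun x y => ~~ (x -- y)) (map f s).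
Proof.
move=> R; elim: s => //= u s IH /andP[hu hs]; rewrite leq_add ?IH // count_map.
elim: s {IH} hs => //= w s IH /andP[hw /IH h]; rewrite leq_add //.
by case K: (known _ _ _ _) => //; rewrite (knownP R hu hw K).
Qed.

Lemma degree_shut f g st v : realizes f g st -> v < nvert st -> shut st v ->
  degree (f v) <= count (fun u => (u != v) && ~~ known false st v u) (named st).
Proof.
move=> R hv sv; rewrite -size_filter -(size_map f); apply: leq_trans (card_size _).
apply/subset_leq_card/subsetP => x; rewrite inE => vx.
have [u hu E] := real_shut R hv sv vx; subst x; apply: map_f.
rewrite mem_filter mem_iota hu !andbT; apply/andP; split.
  by apply: contraTneq vx => ->; rewrite adj_irr.
by apply: contraTN vx => /(knownP R hv hu)->.
Qed.

Lemma sparse_sound st v : sparse v st -> refuted st.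
Proof.
move=> /andP[hv H] f g R; set d := (if _ then _ else _) in H.
have le_d : degree (f v) <= d.
  by rewrite /d; case: ifP => // sv; rewrite leq_min Gdeg (degree_shut R).
have [U S] := known_nbrs R hv; have [d2 le] := Gsparse U S.
case/orP: H => [|H]; first by rewrite ltnNge (leq_trans d2).
(* The bound on nonadjacent pairs is monotone in the degree, so the upper estimate [d] of the degree
   suffices. *)
move: H; apply/negP; rewrite -leqNgt; apply: leq_trans (half_leq (leq_bin2l 2 le_d)).
apply: leq_trans le; apply: nonadj_pairs_map R _.
by apply/allP => u; rewrite mem_filter mem_iota => /andP[].
Qed.

Lemma shut_withinP f g st X u x : realizes f g st -> u < nvert st ->
  shut_within X st u -> f u -- x -> exists2 w, w \in X & x = f w.
Proof.
move=> R hu /andP[su /allP H] ux; have [w hw E] := real_shut R hu su ux.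
have := H w; rewrite mem_iota => /(_ hw) /or3P[wX|/eqP Ew|K]; first by exists w.
  by rewrite E Ew adj_irr in ux.
by move: ux; rewrite E (knownP R hu hw K).
Qed.

(** Containment as a strongly induced subgraph in terms of a numbering: [h] is the inverse of the
    isomorphism. With an empty attachment set it expresses, for connected [G], isomorphism to an
    F_i. *)
Definition occurs (P : pattern) : Prop :=
  exists h : nat -> G,
    let N := psize P + size (pext P) in
    [/\ forall i j, i < N -> j < N -> h i = h j -> i = j,
        forall i j, i < j -> j < N -> (h i -- h j) = below (psize P) (pext P) i j
      & forall j x, j < N -> j \notin pattach P -> h j -- x ->
          exists2 i, i < N & x = h i].

Hypothesis Gpat : forall i P, onth patterns i = Some P -> ~ occurs P.

Lemma pattern_sound st i P m :
  onth patterns i = Some P -> pattern_at P m st -> refuted st.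
Proof.
move=> /Gpat NP /and5P[/eqP Em Um /allP hm /allP H1 /allP H2] f g R; apply: NP.
have lt i' : i' < psize P + size (pext P) -> nth 0 m i' < nvert st.
  by rewrite -Em => hi; apply: hm; apply: mem_nth.
exists (fun j => f (nth 0 m j)); split=> [j k hj hk|j k jk hk|j x hj nj].
- move/(real_inj R (lt _ hj) (lt _ hk))/eqP.
  by rewrite nth_uniq ?Em // => /eqP.
- have := H1 k; rewrite mem_iota Em => /(_ hk)/allP/(_ j).
  rewrite mem_iota => /(_ jk); apply: knownP R (lt _ _) (lt _ _) => //.
  exact: ltn_trans jk hk.
have := H2 j; rewrite mem_iota Em (negPf nj) => /(_ hj) W.
move/(shut_withinP R (lt _ hj) W) => [w wm ->].
by exists (index w m); rewrite ?nth_index // -Em index_mem.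
Qed.

Hypothesis Gconn : connected G.
Hypothesis Gbig : exists v : G, 4 < degree v.

(** The numbered vertices are closed under adjacency, so by connectivity they are all of [G]; but
    some vertex has degree above 4. *)
Lemma small_sound st : small st -> refuted st.
Proof.
move=> /allP H f g R.
have H' v : v < nvert st -> shut st v /\ degree (f v) <= 4.
  move=> hv; have := H v; rewrite mem_iota => /(_ hv) /andP[sv le].
  by split=> //; apply: leq_trans (degree_shut R hv sv) le.
have [u0 hu0] : exists u, u < nvert st.
  have [/andP[+ _] _] := real_stuck R; case E: (cyc st) => [|p l] // _.
  by exists p.1; apply: (real_lt R); rewrite /on_cyc E mem_head.
pose X := [pred x : G | x \in map f (named st)].
have X_closed : closed (@adj G) X.
  apply: intro_closed; first by apply: sym_connect_sym; exact: adj_sym.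
  move=> x y xy /mapP[u]; rewrite mem_iota => hu E; subst x.
  have [w hw ->] := real_shut R hu (H' _ hu).1 xy.
  by rewrite !inE map_f // mem_iota.
have [v hv] := Gbig.
have u0X : f u0 \in X by apply: map_f; rewrite mem_iota.
have : v \in X by rewrite -(closed_connect X_closed (Gconn (f u0) v)).
case/mapP=> u; rewrite mem_iota => hu E.
by move: hv; rewrite E ltnNge (H' _ hu).2.
Qed.

(** * Reduction to an earlier state *)

Lemma thin_expand f g keep l : let bl := thin keep l in
  expand f g l = expand f g bl.1 ++
    flatten [seq f b.1.1 :: g b.1.1 ++ expand f g b.2 | b <- bl.2].
Proof.
elim: l => //= p l IH; case: ifP => _; rewrite /expand /= -!/(expand _ _ _) IH //=.
  by rewrite !catA.
by rewrite !catA.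
Qed.

Lemma thin_names keep l :
  [seq b.1.1 | b <- (thin keep l).2] = [seq u <- [seq p.1 | p <- l] | keep u].
Proof. by elim: l => //= p l IH; case: ifP => _ //=; rewrite IH. Qed.

Lemma thin_mem keep l b : b \in (thin keep l).2 -> b.1 \in l.
Proof.
elim: l => //= p l IH; case: ifP => _ /=; rewrite !inE => h.
  by case/predU1P: h => [->|/IH->]; rewrite ?eqxx ?orbT.
by rewrite IH ?orbT.
Qed.

(** A realization of [st] yields one of [T]: numbers outside [m] are forgotten, and those of them on
    the cycle return to the segments. *)
Lemma instance_sound T m st : refuted T -> instance T m st -> refuted st.
Proof.
move=> HT; rewrite /instance; set c := rot _ _; set bl := thin _ _.
case/and5P=> /eqP Em Um /allP hm /allP He /and5P[/allP Hs /allP Ho /allP HT1 Hb1 /andP[Hb2 Hc]] f g R.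
have lt i : i < nvert T -> nth 0 m i < nvert st.
  by rewrite -Em => hi; apply: hm; apply: mem_nth.
pose B0 : (nat * bool) * seq (nat * bool) := ((0, false), [::]).
(* A block is found by the kept vertex that heads it. These are distinct, and every cycle vertex of
   [T] heads one, so the default [B0] is not met there. *)
pose blk u := nth B0 bl.2 (find (fun b => b.1.1 == u) bl.2).
(* The segment of a kept vertex grows by the dropped vertices after it, with their own segments. *)
pose g' k := g (blk (nth 0 m k)).1.1 ++ expand f g (blk (nth 0 m k)).2.
pose f' k := f (nth 0 m k).
have Ub : uniq [seq b.1.1 | b <- bl.2].
  by rewrite thin_names filter_uniq // /c map_rot rot_uniq; apply: uniq_on_cyc R.
have blkE b : b \in bl.2 -> blk b.1.1 = b.
  move=> bb; rewrite /blk; elim: (bl.2) bb Ub => //= a s IH.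
  rewrite inE; case/predU1P=> [-> _|bs /andP[an Us]]; first by rewrite eqxx.
  case: eqP => [E|_]; last exact: IH.
  by case/negP: an; rewrite E; apply: (map_f (fun b => b.1.1)) bs.
set rel2 := (fun t b => _) in Hc.
have Ec : expand f' g' (cyc T) = expand f g c.
  rewrite (thin_expand f g (fun u => u \in [seq nth 0 m i | i <- on_cyc T])) -/bl.
  rewrite (nilP Hb1) /=.
  have gen l s : all2 rel2 l s -> {subset s <= bl.2} -> expand f' g' l =
      flatten [seq f b.1.1 :: g b.1.1 ++ expand f g b.2 | b <- s].
    elim: l s => [|t l IH] [|b s] //= /andP[/andP[/eqP Et _] Hl] sub.
    rewrite /expand /= -/(expand _ _ _) (IH _ Hl); last first.
      by move=> a h; apply: sub; rewrite inE h orbT.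
    by rewrite /f' /g' -Et blkE ?sub ?mem_head // catA.
  exact: gen Hc _.
have [j Ej] : exists j, expand f g c = rot j (expand f g (cyc st)) by apply: expand_rot.
have Emem : expand f' g' (cyc T) =i expand f g (cyc st) by move=> x; rewrite Ec Ej mem_rot.
apply: (HT f' g'); split.
- move=> u v hu hv /(real_inj R (lt _ hu) (lt _ hv))/eqP.
  by rewrite nth_uniq ?Em // => /eqP.
- move=> u v b hu hv; wlog vu : u v hu hv / v < u.
    move=> W; case: (ltngtP v u) => [|h|->]; first exact: W.
      by rewrite entry_sym /f' adj_sym; apply: W.
    by rewrite /entry ltnn.
  have := He u; rewrite mem_iota => /(_ hu)/allP/(_ v); rewrite mem_iota => /(_ vu) + E.
  by rewrite E; apply: knownP R (lt _ hu) (lt _ hv).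
- move=> u x hu su; have := Hs u; rewrite mem_iota su => /(_ hu) W.
  move/(shut_withinP R (lt _ hu) W) => [w wm ->].
  by exists (index w m); rewrite ?/f' ?nth_index // -Em index_mem.
- apply: stuck_eq Emem (real_stuck R); rewrite Ec Ej is_cycle_rot.
  by case: (real_stuck R).
- move=> p pT np.
  have [b bb] : exists2 b, b \in bl.2 & (b.1.1 == nth 0 m p.1) && (p.2 || ~~ b.1.2 && nilp b.2).
    elim: (bl.2) (cyc T) Hc pT => [|b s IH] [|t l] //= /andP[Hb Hl].
    rewrite inE => /predU1P[->|pl]; first by exists b; rewrite // mem_head.
    by have [a al Ha] := IH _ Hl pl; exists a; rewrite // inE al orbT.
  rewrite (negPf np) => /andP[/eqP Eb /andP[b2 /nilP bn]].
  rewrite /g' -Eb blkE // bn cats0; apply: (real_seg R) b2.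
  by have := thin_mem bb; rewrite /c mem_rot.
- move=> u hu; rewrite Emem (real_on R (lt _ hu)).
  by have := Ho u; rewrite mem_iota => /(_ hu)/eqP.
by move=> u /HT1.
Qed.

(** * Soundness of whole certificates *)

Lemma lemma_refuted lemmas i T :
  refuted_all lemmas -> onth lemmas i = Some T -> refuted T.
Proof.
elim: lemmas i => [|S l IH] [|i] //= [hS hl]; first by case=> <-.
exact: IH hl.
Qed.

Lemma step_sound lemmas o args st sts : refuted_all lemmas ->
  step lemmas o args st = Some sts -> refuted_all sts -> refuted st.
Proof.
move=> H; have leafP b : leaf b = Some sts -> b by case: b.
case: o => /=.
- by case: args => [|u [|v []]] //; apply: split_edge_sound.
- by case: args => [|v []] //; apply: new_nbr_sound.
- by case: args => [|u []] //; apply: next_gap_sound.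
- by case: args => [|u []] //; apply: next_gap_sound.
- by case: args => [|v []] //; apply: close_full_sound.
- by case: args => [|v K] //; apply: connect_nbrs_sound.
- by case: args => // -[<-] [/reverse_sound].
- by move=> /leafP/extends_sound.
- by case: args => [|v []] // /leafP/sparse_sound.
- by case: args => // /leafP/small_sound.
- by case: args => // i m; case E: (onth _ _) => // /leafP/(pattern_sound E).
- case: args => // i m; case E: (onth _ _) => // /leafP.
  by move/(instance_sound (lemma_refuted H E)).
Qed.

Lemma run_sound lemmas cert args stack : refuted_all lemmas ->
  run lemmas cert args stack -> refuted_all stack.
Proof.
move=> H; elim: cert args stack => [|c cert IH] args stack /=; first by move/nilP->.
case: (digit c) => [d|]; first exact: IH.
case: (blank c); first exact: IH.
case: (op_of c) stack => [o|] [|st stack] //.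
case E: (step _ _ _ _) => [sts|] // /IH/refuted_all_cat[h1 h2].
by split=> //; apply: step_sound H E h1.
Qed.

Lemma run_all_sound lemmas certs : refuted_all lemmas ->
  run_all lemmas certs -> refuted_all [seq c.1 | c <- certs].
Proof.
elim: certs lemmas => //= -[st cert] certs IH lemmas H.
case/andP=> /(run_sound H)[Hst _] /IH Hc; split=> //; apply: Hc.
by rewrite -cats1; apply/refuted_all_cat; split.
Qed.

End Soundness.

(** * Clustering, exceptional subgraphs and spanning cycles *)

(** Edges and nonadjacent pairs give disjoint families of two-element subsets of the neighbourhood:
    [D] has all of these, and [J] separates those that contain an edge. *)
Lemma nonadj_pairs_leq (G : sgraph) (v : G) (s : seq G) :
  uniq s -> {subset s <= nbhd v} ->
  #|edges (induced (nbhd v))| + nonadj_pairs (fun x y => ~~ (x -- y)) s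
    <= 'C(degree v, 2).
Proof.
move=> U S; pose W := nbhd v.
pose D := [set A : {set G} | A \subset W & #|A| == 2].
pose J := [set A : {set G} | [exists x in A, [exists y in A, x -- y]]].
have <- : #|D| = 'C(degree v, 2) by rewrite cards_draws.
rewrite -(cardsID J D) leq_add //.
  rewrite -(card_imset _ (imset_inj (@val_inj _ _ _))).
  apply/subset_leq_card/subsetP => _ /imsetP[e + ->].
  rewrite inE => /existsP[x /existsP[y /andP[xy /eqP->]]].
  have xy' : val x -- val y by [].
  have vxy : val x != val y by apply: contraTneq xy' => ->; rewrite adj_irr.
  rewrite imsetU1 imset_set1 !inE cards2 vxy subUset !sub1set !(valP x, valP y) /=.
  apply/existsP; exists (val x); rewrite !inE eqxx /=.
  by apply/existsP; exists (val y); rewrite !inE eqxx orbT.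
(* The counted pairs as actual sets, to be placed in [D] minus [J]. *)
pose fix pairs s : seq {set G} :=
  if s is a :: s' then [seq [set a; b] | b <- s' & ~~ (a -- b)] ++ pairs s' else [::].
have -> : nonadj_pairs (fun x y => ~~ (x -- y)) s = size (pairs s).
  by elim: (s) => //= a t IH; rewrite size_cat size_map size_filter IH.
have sub t A : A \in pairs t -> {subset A <= t}.
  elim: t => //= a t IH; rewrite mem_cat => /orP[|/IH h x /h xt].
    case/mapP=> b; rewrite mem_filter => /andP[_ bt] -> x.
    by rewrite !inE => /orP[/eqP->|/eqP->]; rewrite ?eqxx ?bt ?orbT.
  by rewrite inE xt orbT.
have Up : uniq (pairs s).
  elim: s U {S} => //= a t IH /andP[at_ U]; rewrite cat_uniq IH // andbT.
  apply/andP; split.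
    rewrite map_inj_in_uniq ?filter_uniq // => b c.
    rewrite !mem_filter => /andP[_ bt] /andP[_ ct] /setP/(_ b).
    rewrite !inE eqxx orbT => /esym/orP[/eqP E|/eqP//].
    by rewrite -E bt in at_.
  apply/hasPn => A /sub At; apply: contra at_ => /mapP[b _ E].
  by apply: At; rewrite E !inE eqxx.
rewrite -(card_uniqP Up); apply/subset_leq_card/subsetP.
elim: s U S {Up} => //= a t IH /andP[at_ U] S A; rewrite mem_cat => /orP[|]; last first.
  by apply: IH => // x xt; apply: S; rewrite inE xt orbT.
case/mapP=> b; rewrite mem_filter => /andP[ab bt] ->.
have nab : a != b by apply: contraNneq at_ => ->.
rewrite !inE cards2 nab subUset !sub1set !S ?inE ?eqxx ?bt ?orbT //= andbT.
rewrite negb_exists; apply/forallP => x; rewrite !inE.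
case: eqP => [->|_] /=; last case: eqP => [->|//] /=.
  rewrite negb_exists; apply/forallP => y; rewrite !inE.
  by do 2! [case: eqP => [->|_] /=; rewrite ?adj_irr ?ab ?(negPf ab) //].
rewrite negb_exists; apply/forallP => y; rewrite !inE [b -- y]adj_sym.
by do 2! [case: eqP => [->|_] /=; rewrite ?adj_irr ?ab ?(negPf ab) //].
Qed.

(** With E edges and N nonadjacent pairs among C pairs of neighbours, the clustering bound gives C
    at most 2E; since E + N is at most C, also 2N is at most C. *)
Lemma sparse_nbhd (G : sgraph) (v : G) (s : seq G) :
  (1 / 2%:R <= min_clustering G)%R -> uniq s -> {subset s <= nbhd v} ->
  1 < degree v /\
  nonadj_pairs (fun x y => ~~ (x -- y)) s <= 'C(degree v, 2)./2.
Proof.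
move=> /le_trans/(_ (bigmin_le _ v _)); rewrite /clustering => H U S.
have := nonadj_pairs_leq U S; move: H.
set E := #|_|; set C := 'C(_, _); set N := nonadj_pairs _ _ => H le.
(* Division by zero gives 0, so [C] = 0 would make the coefficient 0. *)
have C0 : 0 < C.
  by rewrite lt0n; apply: contraTneq H => ->; rewrite invr0 mulr0.
split; first by rewrite -bin_gt0.
have {H} CE : C <= E.*2.
  move: H; rewrite ler_pdivlMr ?ltr0n // mulrAC ler_pdivrMr ?ltr0n // mul1r.
  by rewrite -natrM ler_nat muln2.
rewrite -[N]doubleK; apply: half_leq; rewrite -(leq_add2l E.*2) -doubleD.
by rewrite (leq_trans (_ : _ <= C.*2)) ?leq_double // -addnn leq_add2r.
Qed.

(** * Patterns and strongly induced subgraphs *)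

Lemma occurs_strong (G : sgraph) k L att : occurs G (Pattern k L att) ->
  contains_strongly_induced G (clique_ext k L) (clique_ext_set att).
Proof.
case=> h /= [h_inj h_adj h_shut].
pose W := [set h i | i : 'I_(k + size L)].
have hW (i : 'I_(k + size L)) : h i \in W by apply: imset_f.
exists W, [set h i | i : 'I_(k + size L) & val i \in att]; split.
  split; first by apply/subsetP => _ /imsetP[i _ ->].
  move=> x y; rewrite inE => /andP[+ /imsetP[i _ E]]; subst x => nS hy.
  have [|j lt ->] := h_shut i y (ltn_ord i) _ hy; last exact: (hW (Ordinal lt)).
  by apply: contra nS => ia; apply/imsetP; exists i; rewrite ?inE.
pose k0 (i : clique_ext k L) : induced W := exist _ (h i) (hW i).
have k0_inj : injective k0.
  move=> i j [] E; apply: val_inj.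
  exact: h_inj (ltn_ord i) (ltn_ord j) E.
have cW : #|W| = k + size L.
  rewrite card_imset ?card_ord // => i j E; apply: val_inj.
  exact: h_inj (ltn_ord i) (ltn_ord j) E.
(* The isomorphism is the inverse of the numbering, which exists by counting. *)
have [f fK Kf] : bijective k0.
  by apply: inj_card_bij => //; rewrite card_sig cW card_ord.
have h_mono (i j : clique_ext k L) : (h i -- h j) = (i -- j).
  wlog lt : i j / i < j.
    move=> H; case: (ltngtP i j) => [|ji|/val_inj->]; first exact: H.
      by rewrite adj_sym H // adj_sym.
    by rewrite !adj_irr.
  rewrite h_adj // /adj /= /clique_ext_adj orbC.
  by rewrite {2}/below ltnNge (ltnW lt).
exists f; split.
  split; first by exists k0.
  by move=> x y; rewrite -{2}[x]Kf -{2}[y]Kf -h_mono.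
apply/setP => i; rewrite inE; apply/imsetP/idP => [[x + ->]|ia].
  rewrite inE => /imsetP[j]; rewrite inE => ja E.
  have -> : x = k0 j by apply: val_inj.
  by rewrite fK.
exists (k0 i); last by rewrite fK.
by rewrite inE; apply/imsetP; exists i; rewrite ?inE.
Qed.

(** With an empty attachment set the copy is closed under adjacency, and it is nonempty; by
    connectivity it is all of [G]. *)
Lemma occurs_iso (G : sgraph) k L : connected G -> 0 < k ->
  occurs G (Pattern k L [::]) -> isomorphic G (clique_ext k L).
Proof.
move=> Gc k0 /occurs_strong[W [S [[_ HW] [f [[fb fm] fS]]]]].
have S0 x : x \in W -> x \notin S.
  move=> xW; apply/negP => xS.
  have : f (exist _ x xW) \in (clique_ext_set [::] : {set clique_ext k L}).
    by rewrite -fS; apply: imset_f; rewrite inE.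
  by rewrite inE.
have W_closed : closed (@adj G) (mem W).
  apply: intro_closed; first by apply: sym_connect_sym; exact: adj_sym.
  by move=> x y xy xW; apply: HW xy; rewrite inE S0.
have [g fK gK] := fb.
have lt0 : 0 < k + size L by rewrite ltn_addr.
pose w := g (Ordinal lt0 : clique_ext k L).
have all_W x : x \in W.
  by rewrite -(closed_connect W_closed (Gc (val w) x)); apply: valP w.
exists (fun x => f (exist _ x (all_W x))); split.
  exists (fun i => val (g i)) => [x|i]; first by rewrite fK.
  by rewrite -[RHS]gK; congr f; apply: val_inj.
by move=> x y; rewrite fm.
Qed.

Lemma strong_occurs (G : sgraph) k L att : 0 < k ->
  contains_strongly_induced G (clique_ext k L) (clique_ext_set att) ->
  occurs G (Pattern k L att).
Proof.
move=> k0 [W [S [[SW HW] [f [[[g fK gK] fm] fS]]]]].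
have N0 : 0 < k + size L by rewrite ltn_addr.
(* [occurs] numbers by naturals, so indices out of range are sent to vertex 0. *)
pose o i : clique_ext k L := insubd (Ordinal N0) i.
have oE i : i < k + size L -> val (o i) = i by move=> lt; rewrite val_insubd lt.
exists (fun i => val (g (o i))); split=> /= [i j hi hj /val_inj/(can_inj gK)/(congr1 val)|i j ij hj|j x hj ja].
- by rewrite !oE.
- have hi := ltn_trans ij hj.
  change (g (o i) -- g (o j) = below k L i j); rewrite -fm !gK.
  by rewrite /adj /= /clique_ext_adj orbC {1}/below !oE // ltnNge (ltnW ij).
move=> jx; have xW : x \in W.
  apply: HW jx; rewrite inE (valP (g (o j))) andbT; apply/negP => jS.
  have : o j \in (clique_ext_set att : {set clique_ext k L}).
    by rewrite -fS -[o j]gK imset_f // inE.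
  by rewrite inE oE // (negPf ja).
exists (val (f (exist _ x xW))); first exact: ltn_ord.
have -> : o (val (f (exist _ x xW))) = f (exist _ x xW).
  by apply: val_inj; rewrite oE // ltn_ord.
by rewrite fK.
Qed.

Lemma iso_strong (G H : sgraph) :
  isomorphic G H -> contains_strongly_induced G H set0.
Proof.
case=> f [[g fK gK] fm]; exists [set: G], set0; split.
  by split=> [|x y _ _]; rewrite ?sub0set ?inE.
exists (fun x => f (val x)); split; last first.
  by apply/setP => y; rewrite inE; apply/imsetP => -[x]; rewrite !inE.
split; last by move=> x y; apply: fm.
exists (fun y => exist _ (g y) (in_setT (g y))) => [x|y] /=; last exact: gK.
by apply: val_inj; rewrite /= fK.
Qed.

Lemma iso_occurs (G : sgraph) k L : 0 < k ->
  isomorphic G (clique_ext k L) -> occurs G (Pattern k L [::]).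
Proof.
move=> k0 /iso_strong; have -> : set0 = clique_ext_set [::] :> {set clique_ext k L}.
  by apply/setP => i; rewrite !inE.
exact: strong_occurs.
Qed.

Lemma iso_trans (G H K : sgraph) :
  isomorphic G H -> isomorphic H K -> isomorphic G K.
Proof.
move=> [f [fb fm]] [g [gb gm]]; exists (g \o f); split; first exact: bij_comp.
by move=> x y; rewrite /= gm fm.
Qed.

Lemma iso_sym (G H : sgraph) : isomorphic G H -> isomorphic H G.
Proof.
move=> [f [[g fK gK] fm]]; exists g; split; first by exists f.
by move=> x y; rewrite -fm !gK.
Qed.

(** [unsplit] numbers the triangle of the join by 0, 1, 2 and the independent vertices by 3 to 6;
    adjacency is then checked vertex by vertex. *)
Lemma F1_iso : isomorphic F1
  (clique_ext 3 [:: [:: 0; 1; 2]; [:: 0; 1; 2]; [:: 0; 1; 2]; [:: 0; 1; 2]]).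
Proof.
exists (@unsplit 3 4); split.
  by exists (@split 3 4); [apply: unsplitK | apply: splitK].
case=> i [] j.
- by case: i => [[|[|[|//]]] ?]; case: j => [[|[|[|//]]] ?].
- by case: i => [[|[|[|//]]] ?]; case: j => [[|[|[|[|//]]]] ?].
- by case: i => [[|[|[|[|//]]]] ?]; case: j => [[|[|[|//]]] ?].
by case: i => [[|[|[|[|//]]]] ?]; case: j => [[|[|[|[|//]]]] ?].
Qed.

Definition avoids_patterns (G : sgraph) : Prop :=
  forall i P, onth patterns i = Some P -> ~ occurs G P.

Lemma avoids_patternsP (G : sgraph) : connected G ->
  avoids_patterns G <->
  ([/\ ~ isomorphic G F1, ~ isomorphic G F2, ~ isomorphic G F3
     & ~ isomorphic G F4] /\
   [/\ ~ contains_strongly_induced G H1 S1,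
       ~ contains_strongly_induced G H2 S2,
       ~ contains_strongly_induced G H3 S3,
       ~ contains_strongly_induced G H4 S4
     & ~ contains_strongly_induced G H5 S5]).
Proof.
move=> Gc; split=> [H|[[f1 f2 f3 f4] [h1 h2 h3 h4 h5]]].
  split; split=> X.
  - by apply: (H 5 _ erefl); apply: iso_occurs (iso_trans X F1_iso).
  - by apply: (H 6 _ erefl); apply: iso_occurs X.
  - by apply: (H 7 _ erefl); apply: iso_occurs X.
  - by apply: (H 8 _ erefl); apply: iso_occurs X.
  - by apply: (H 0 _ erefl); apply: strong_occurs X.
  - by apply: (H 1 _ erefl); apply: strong_occurs X.
  - by apply: (H 2 _ erefl); apply: strong_occurs X.
  - by apply: (H 3 _ erefl); apply: strong_occurs X.
  by apply: (H 4 _ erefl); apply: strong_occurs X.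
case=> [|[|[|[|[|[|[|[|[|i]]]]]]]]] P /=; last by rewrite onth0n.
- by case=> <- /occurs_strong.
- by case=> <- /occurs_strong.
- by case=> <- /occurs_strong.
- by case=> <- /occurs_strong.
- by case=> <- /occurs_strong.
- case=> <- /(occurs_iso (k := 3) Gc isT) X; apply: f1.
  exact: iso_trans X (iso_sym F1_iso).
- by case=> <- /(occurs_iso (k := 3) Gc isT).
- by case=> <- /(occurs_iso (k := 4) Gc isT).
by case=> <- /(occurs_iso (k := 4) Gc isT).
Qed.

(** * Necessity: barriers to a spanning cycle *)

(** The successors on [c] of vertices of [I] lie in [A] and, by size, fill it; so do the
    predecessors. Hence the successor of a vertex of [A] is back in [I], the cycle never leaves the
    two sets, and [w] is missed. *)
Lemma not_spanning (G : sgraph) (c A I : seq G) (w : G) :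
  is_cycle c -> (forall v, v \in c) -> uniq I ->
  0 < size I -> size A <= size I ->
  {in I, forall x y, x -- y -> y \in A} -> w \notin I ++ A -> False.
Proof.
move=> /andP[sc /andP[C U]] cT UI I0 AI HI wIA.
have next_inj : injective (next c) := can_inj (prev_next U).
have prev_inj : injective (prev c) := can_inj (next_prev U).
have onto h : injective h -> (forall x, x -- h x) -> A =i map h I.
  move=> h_inj xh.
  have sub : {subset map h I <= A} by move=> _ /mapP[x xI ->]; apply: HI xI _ (xh x).
  have Uh : uniq (map h I) by rewrite map_inj_uniq.
  have le : size A <= size (map h I) by rewrite size_map.
  by move=> x; rewrite (uniq_min_size Uh sub le).2.
have next_adj x : x -- next c x by apply: next_cycle C (cT x).
have prev_adj x : x -- prev c x by rewrite adj_sym; apply: prev_cycle C (cT x).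
have next_in x : x \in I ++ A -> next c x \in I ++ A.
  rewrite !mem_cat => /orP[xI|]; first by rewrite (HI x xI _ (next_adj x)) orbT.
  by rewrite (onto _ prev_inj prev_adj) => /mapP[y yI ->]; rewrite next_prev ?yI.
case: I {UI AI HI onto next_in} I0 wIA next_in => // x I _ wIA next_in.
case/negP: wIA.
have : fconnect (next c) x w by rewrite (fconnect_cycle (cycle_next U)) ?cT.
move/iter_findex <-; elim: (findex _ _ _) => [|n IH] /=.
  by rewrite mem_head.
exact: next_in.
Qed.

(* (a, b, w): vertices b, ..., b + a - 1 have all their neighbours among
   0, ..., a - 1, and w is a further vertex. *)
Definition barriers : seq (nat * nat * nat) :=
  [:: (2, 4, 2); (2, 5, 2); (3, 3, 6); (3, 5, 3); (3, 3, 6);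
      (3, 3, 6); (3, 3, 6); (4, 4, 8); (4, 4, 8)].

Definition is_barrier (P : pattern) (t : nat * nat * nat) : bool :=
  let: (a, b, w) := t in let N := psize P + size (pext P) in
  [&& 0 < a, b + a <= N, w < N, w \notin iota b a ++ iota 0 a
    & all (fun i => (i \notin pattach P) &&
        all (fun j => below (psize P) (pext P) i j || below (psize P) (pext P) j i
                      ==> (j < a)) (iota 0 N)) (iota b a)].

Lemma barrier_not_spanning (G : sgraph) (c : seq G) P t :
  occurs G P -> is_barrier P t -> is_cycle c -> (forall v, v \in c) -> False.
Proof.
case: t => [[a b] w] [h /= [h_inj h_adj h_shut]].
set N := psize P + _ => /and5P[a0 le_bN ltw wn /allP HI] cc cT.
have ltI i : i \in iota b a -> i < N.
  by rewrite mem_iota => /andP[_ lt]; apply: leq_trans le_bN.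
have ltA i : i \in iota 0 a -> i < N.
  by rewrite mem_iota => lt; apply: leq_trans lt (leq_trans (leq_addl _ _) le_bN).
apply: (@not_spanning G c (map h (iota 0 a)) (map h (iota b a)) (h w)) => //.
- by rewrite map_inj_in_uniq ?iota_uniq // => i j /ltI hi /ltI hj; apply: h_inj.
- by rewrite size_map size_iota.
- by rewrite !size_map !size_iota.
- move=> _ /mapP[i iI ->] y ay; have /andP[ia /allP Hi] := HI _ iI.
  have [j ltj Ey] := h_shut i y (ltI _ iI) ia ay; subst y; apply: map_f.
  rewrite mem_iota; apply: (implyP (Hi j _)); first by rewrite mem_iota.
  case: (ltngtP i j) => [ij|ji|E].
  + by move: ay; rewrite h_adj // => ->.
  + by move: ay; rewrite adj_sym h_adj ?ltI // => ->; rewrite orbT.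
  by rewrite E adj_irr in ay.
rewrite -map_cat; apply: contra wn => /mapP[i ii E].
by rewrite (h_inj w i ltw _ E) //; move: ii; rewrite mem_cat => /orP[/ltI|/ltA].
Qed.

(** A triangle at [v] is extended repeatedly; the number of missed vertices decreases each time. *)
Lemma fce_spanning (G : sgraph) (v : G) : fully_cycle_extendable G ->
  exists2 c : seq G, is_cycle c & forall x, x \in c.
Proof.
case=> tri ext; have [x [y [vx xy yv]]] := tri v.
have: is_cycle [:: v; x; y].
  rewrite /is_cycle /ucycleb /= vx xy yv !inE negb_or !andbT -andbA.
  have ne a b : a -- b -> a != b by apply: contraTneq => ->; rewrite adj_irr.
  by rewrite !ne // adj_sym.
move: [:: v; x; y] => c; have [n] := ubnP #|[predC c]|; elim: n c => // n IH c lt cc.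
have [/forallP cT|] := boolP [forall z, z \in c]; first by exists c.
rewrite negb_forall => /existsP nc; have [z [c' [zc c'c E]]] := ext c cc nc.
apply: (IH c') => //; rewrite ltnS in lt; apply: leq_trans lt; apply: proper_card.
apply/properP; split.
  by apply/subsetP => u; rewrite !inE E inE negb_or => /andP[].
by exists z; rewrite !inE // E inE eqxx.
Qed.

Lemma fce_avoids (G : sgraph) (v : G) :
  fully_cycle_extendable G -> avoids_patterns G.
Proof.
move=> /(fce_spanning v)[c cc cT] i P iP occ.
have ok : all2 is_barrier patterns barriers by vm_compute.
have : exists t, is_barrier P t.
  elim: patterns barriers i iP ok => [|Q l IH] [|t s] [|i] //=.
    by case=> -> /andP[Pt _]; exists t.
  by move=> iP /andP[_]; apply: IH iP.
by case=> t Pt; apply: barrier_not_spanning occ Pt cc cT.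
Qed.

(** * Sufficiency: the initial configuration and the certificates *)

(* x = 0 on the cycle is adjacent to all other numbered vertices; y = 1 off the
   cycle and z = 2 on it are adjacent; 3 and 4 are the successor and the
   predecessor of x. The flag tells whether x has no further neighbours. *)
Definition hub (b : bool) (n : nat) (c : seq (nat * bool)) : state :=
  State [:: (b, [::]), (false, [:: Some true]), (false, nseq 2 (Some true))
          & nseq n (false, [:: Some true])] c.

(** The configuration present at every cycle that neither spans nor extends: [z] is neither the
    successor nor the predecessor of [x]. *)
Definition start : state :=
  hub false 2 [:: (4, false); (0, false); (3, true); (2, true)].

(** Connectivity gives an edge from some [x] on the cycle to a vertex off it, and local connectivity
    at [x] an edge from some [y] off the cycle to some [z] on it. If [z] followed or preceded [x],
    then [y] could be inserted between them. *)
Lemma start_realized (G : sgraph) (c : seq G) : connected G ->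
  locally_connected G -> stuck c -> (exists v, v \notin c) ->
  exists (f : nat -> G) (g : nat -> seq G), realizes f g start.
Proof.
move=> Gc Glc Cs [v vc]; have [/andP[c3 /andP[Cc Uc]] Ne] := Cs.
have [x0 x0c] : exists x0, x0 \in c.
  by case: (c) c3 => // x l _; exists x; rewrite mem_head.
have [x [y0 [xc y0c xy0]]] : exists x y0, [/\ x \in c, y0 \notin c & x -- y0].
  have [/existsP[x /existsP[y /and3P[*]]]|none] := boolP
    [exists x, exists y, [&& x \in c, y \notin c & x -- y]]; first by exists x, y.
  have c_closed : closed (@adj G) (mem c).
    apply: intro_closed; first by apply: sym_connect_sym; exact: adj_sym.
    move=> x y xy xc; apply: contraR none => yc.
    by apply/existsP; exists x; apply/existsP; exists y; apply/and3P; split.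
  by move: vc; rewrite -(closed_connect c_closed (Gc x0 v)) x0c.
have [i [|s l] Ei] := rot_to xc; first by move: c3; rewrite -(size_rot i) Ei.
have cE : rot i c =i c by move=> u; rewrite mem_rot.
have Cs' : stuck (x :: s :: l).
  by rewrite -Ei; apply: (stuck_eq _ cE Cs); rewrite is_cycle_rot; case: Cs.
have cE' u : (u \in c) = (u \in x :: s :: l) by rewrite -Ei cE.
move: {Ei c3 Cc Uc Ne x0c vc cE} xc y0c; rewrite !cE' => xc y0c.
move: Cs' => {c cE'} {}Cs.
have [/andP[c3 /andP[Cc Uc]] Ne] := Cs.
have xs : x -- s by move: Cc => /= /andP[].
have sc : s \in x :: s :: l by rewrite !inE eqxx orbT.
have [y [z [xy yc xz zc yz]]] : exists y z, [/\ x -- y, y \notin x :: s :: l,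
    x -- z, z \in x :: s :: l & y -- z].
  (* The set of vertices off the cycle contains the neighbour [y0] of [x] but not the neighbour [s],
     so an edge of the neighbourhood leaves it. *)
  have [|y [z [? ? ? /negPn ? ?]]] := @local_edge G Glc x y0 s [predC x :: s :: l] xy0 y0c xs.
    by apply/negPn.
  by exists y, z.
have zx : z != x by apply: contraTneq xz => ->; rewrite adj_irr.
have zs : z != s.
  apply/eqP => E; subst z; apply: Ne; exists y, (x :: y :: s :: l); split=> //.
    have /andP[_ Cl] : (x -- s) && path adj s (rcons l x) := Cc.
    move: yc Uc; rewrite /is_cycle /ucycleb /= xy yz Cl !inE !negb_or.
    case/and3P=> yx ys yl /and3P[/andP[xs' xl] sl Ul].
    by rewrite eq_sym yx xs' xl ys yl sl.
  by move=> u; rewrite !inE; do 2! case: (u == _).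
case/lastP: l => [|l p] in c3 Cc Uc Ne Cs xc yc zc sc y0c *.
  by move: c3.
have zp : z != p.
  apply/eqP => E; subst z; apply: Ne; exists y, [:: y, x, s & rcons l p]; split=> //.
    have /and3P[_ Cl _] : [&& x -- s, path adj s (rcons l p) & p -- x].
      by move: Cc; rewrite /= rcons_path last_rcons.
    rewrite /is_cycle /ucycleb cons_uniq yc Uc /= rcons_path last_rcons Cl xs.
    by rewrite adj_sym xy adj_sym yz.
have {zc} zl : z \in l.
  by move: zc; rewrite !inE mem_rcons inE (negPf zx) (negPf zs) (negPf zp).
case/splitPr: zl => r1 r2 in c3 Cc Uc Ne Cs xc yc sc y0c *.
pose f := nth x [:: x; y; z; s; p].
(* [r1] lies between [s] and [z], and [r2] between [z] and [p]. The state lists the cycle from [p]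
   on, which is a rotation by one. *)
pose g := nth [::] [:: [::]; [::]; r2; r1].
have Ec : rcons (expand f g (behead (cyc start))) p = [:: x, s & rcons (r1 ++ z :: r2) p].
  by rewrite /expand /= cats0 !rcons_cat /= .
have Ex : expand f g (cyc start) =i [:: x, s & rcons (r1 ++ z :: r2) p].
  by move=> u; rewrite -Ec mem_rcons /expand /= inE.
have px : p -- x by move: Cc; rewrite /= rcons_path last_rcons => /and3P[].
have ne a b : a -- b -> a != b by apply: contraTneq => ->; rewrite adj_irr.
have [yx ys yp] : [/\ y != x, y != s & y != p].
  by move: yc; rewrite !inE mem_rcons inE !negb_or => /and4P[].
have sp : s != p.
  by move: Uc => /and3P[_ + _]; rewrite mem_rcons inE negb_or => /andP[].
have Un : uniq [:: x; y; z; s; p].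
  by rewrite /= !inE !negb_or eq_sym yx eq_sym zx ne // (eq_sym x) ne // ne // ys yp zs zp sp.
exists f, g; split.
- by move=> u w hu hw /eqP; rewrite nth_uniq // => /eqP.
- move=> u w b; case: u => [|[|[|[|[|u]]]]] //; case: w => [|[|[|[|[|w]]]]] //= _ _ [<-];
    rewrite /f /=; first [by [] | by rewrite adj_sym].
- by move=> [|[|[|[|[|]]]]].
- apply: (stuck_eq _ Ex Cs); rewrite -(is_cycle_rot 1).
  have -> : rot 1 (expand f g (cyc start)) = [:: x, s & rcons (r1 ++ z :: r2) p].
    by rewrite -Ec; apply: rot1_cons.
  by case: Cs.
- by move=> q; rewrite !inE => /or4P[] /eqP->.
- move=> u hu; rewrite Ex /on_cyc /=; move: hu.
  rewrite (_ : nvert start = 5) //; case: u => [|[|[|[|[|u]]]]] // _; rewrite /f /=.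
  + exact: negbTE.
  + by rewrite !inE mem_rcons inE mem_cat mem_head !orbT.
  by rewrite !inE mem_rcons mem_head !orbT.
by move=> u; rewrite !inE => /or4P[] /eqP->.
Qed.

(** Extendability is decidable, as a longer cycle is a tuple of known length over a finite type. A
    proof by contradiction is thus enough. *)
Lemma extendable_NNP (G : sgraph) (c : seq G) :
  is_cycle c -> ~ ~ extendable c -> extendable c.
Proof.
move=> /and3P[_ _ U] N.
have [/existsP[y /existsP[t /and3P[yc ct /allP sub]]]|none] := boolP
    [exists y, exists t : (size c).+1.-tuple G,
      [&& y \notin c, is_cycle t & all (mem t) (y :: c)]].
  exists y, (val t); split=> // x.
  by rewrite (uniq_min_size _ sub _).2 //= ?yc ?size_tuple.
case: N => -[y [c' [yc cc' E]]]; case/negP: none; apply/existsP; exists y.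
have /and3P[_ _ U'] := cc'.
have sz : size c' == (size c).+1.
  by apply/eqP/(@perm_size _ c' (y :: c))/uniq_perm; rewrite //= yc.
apply/existsP; exists (Tuple sz); apply/and3P; split=> //.
by apply/allP => x; rewrite /= E.
Qed.

(* Found by computer search. The first four states have x of degree 6, for the
   different positions of its two neighbours 5 and 6; the next two have x of
   degree 5. Each is used as a lemma for the later ones. *)
Definition certificates : seq (state * string) := [::
  (hub false 4 [:: (4, false); (0, false); (3, true); (2, true)], "
    0K36A60423E46A60324E35A50423E45A50324E31A10423E41A10324E62A52A01256C3B34A10
    342E42A51A61A65A2K2G3N4N10215634P402C302C0U0U0U0U2K2G2G43A10432E32A51A61A65
    A2K3B3N4N10215634P402C302C0U0U0U0U2K3B32A42A43A2N3B10342E2K3B10342E2K2G1043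
    72E2K3B103472E0U0U0U32A42A43A52A2N3B10342E2K3B10342E2K2G104372E2K3B103472E0
    U0U0U0U");
  (hub false 4 [:: (4, false); (0, false); (3, true); (6, true); (2, true)], "
    0K35A504263E45A503624E31A104263E41A103624E62A52A6B65A524036E61A124036E34A10
    6342E64A103642E0U75A5240367E71A1240367E74A1036742E32A2K2G42A2K2G43A1043672E
    63A76A65A3B37A5240376E64A6U51A61A6K6G3N4N7N302615473P726C402C306C0U0U6K0U61
    A64A73A6K3B6G1037246E6U0U0U201456C012456C65A64A20156C2K2G2K2G2K2G2K2G127630
    48E2K2G2K2G2K2G2K2G52763048E61A6K3B63A73A6K3B1037642E6U0U2K2G2K2G2K2G2K2G85
    A52763048E81A12763048E61A6K3B63A76A6K2U0U43A61A63A3B1034276E6K6G0U0U0U43A61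
    A63A64A3B1034276E6K6G0U0U0U0U42A2G43A104362E6B61A124036E64A103642E0U71A1240
    367E74A1036742E32A2K75A5042367E76A73A65A64A61A6K3B63A6K3B1037642E0U61A63A6K
    3B1042376E0U0U61A63A64A6K3B6G1037246E0U0U0U61A63A64A65A6K6K3B6G3N4N7N226073
    41P726C4026C3026C2U2U2U61A63A64A73A3B1037642E6K6G2U2U2U2U61A63A64A65A76A6K6
    K6G0U0U0U0U71A1036247E2N6B61A1274036E34A1063472E64A1036472E0U2K6B61A1274036
    E34A1063472E64A1036472E0U2K6B61A12740386E34A10683472E64A10386472E0U2K8B81A1
    2740368E87A10368742E84A10368472E61A64A76A86A6K0U2U2U2U2U2K6B61A12784036E34A
    10634872E64A10364872E0U2G71A1263047E73A1047362E6B61A1274036E34A1063472E64A1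
    036472E0U81A12740368E32A78A10478632E61A63A76A86A6K0U2U2U2U2U61A63A64A65A86A
    6K6K6G0U0U0U0U6B71A1240367E74A1036742E52A75A5240367E2G43A1043672E32A2U61A63
    A64A65A76A6U3B6N6G6K6G6K6G85A50364278E38A10387246E48A10364872E81A10364278E6
    U6K6G0U0U0U0U85A52763048E81A12763048E83A10483672E32A2U42A2U43A61A63A64A65A7
    6A6U3B10348276E6K6G0U0U0U0U0U32A75A5042367E2G43A1043672E61A63A64A65A76A6U3B
    37A1037642E2N2U2U2U6K6G0U0U0U0U81A12763048E87A10487632E83A10483672E42A2U43A
    61A63A64A65A73A76A6U3B10284376E6K6G2U0U0U0U0U0U43A61A63A64A65A75A5024367E76
    A6U3B1034276E6K6G0U0U0U0U0U");
  (hub false 4 [:: (4, false); (0, false); (3, true); (5, true); (2, true);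
                 (6, true)], "
    0K31A1046253E41A1035264E62A52A42A2N5B2G51A1246035E34A1053462E63A1046352E56A
    1035642E54A1035462E61A1035246E0U2K5B2G51A1246035E34A1053462E63A1046352E56A1
    035642E54A1035462E61A1035246E0U2K5B2G51A12460375E34A10573462E63A10463752E56
    A10375642E54A10375462E61A10375246E0U2K7B2G71A12460357E43A10643572E63A104635
    72E76A10357642E74A10357462E61A10357246E53A75A65A3B37A10375642E51A5U54A64A5K
    5G1N3N7N302546173P725C725C305C305C102C102C0U0U5K0U51A54A73A5K3B5G10372645E5
    U0U0U201456C012456C2K5B2G51A12764035E34A10534672E73A10467352E57A10357642E54
    A10354672E71A10352467E76A74A65A64A7B10356472E6K0U61A63A6K6G0U0U61A63A64A6K6
    G10352476E0U0U0U61A64A65A6K7B6G1N4N7N22607145P726C726C4026C4026C1026C1026C2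
    U2U2U61A64A65A74A6G10352476E6K7B2U2U2U2U2K5B2G51A12476035E34A10534762E63A10
    476352E56A10356742E54A10354762E61A10352476E0U32A2N5B2G61A1235046E34A1053462
    E65A1046532E63A1046352E51A1046235E54A1035462E0U2K5B2G61A1235046E34A1053462E
    65A1046532E63A1046352E51A1046235E54A1035462E0U2K5B2G61A12375046E34A10573462
    E65A10465732E63A10463752E51A10462375E54A10375462E0U2K7B2G61A12753046E43A106
    43572E67A10467532E63A10463572E71A10462357E74A10357462E75A73A65A54A51A5K3B53
    A5K3B10375462E0U51A53A5K3B10462375E0U0U51A53A54A5K3B5G10372645E0U0U0U51A53A
    54A5K2U65A5K3B5G1N3N7N22507136P725C725C3025C3025C1025C1025C0U2U2U51A53A65A7
    3A3B10462375E5K5G2U2U2U2U2K5B2G71A12350467E34A10534672E75A10467532E73A10467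
    352E51A10467235E54A10354672E64A76A65A7B47A10356472E61A6U63A6K6G53A1N4N7N302
    635174P726C726C406C406C102C102C0U0U6K0U61A63A74A6K7B10352746E6U0U0U201356C0
    12356C2K5B2G61A12350476E34A10534762E65A10476532E63A10476352E51A10476235E54A
    10354762E0U2G61A1253046E43A1064352E63A1046352E51A53A54A65A5K5G1035462E0U0U0
    U0U71A12530467E73A10467352E2N5B51A12764035E34A10534672E54A10354672E61A63A64
    A65A76A6K6K7B0U0U0U0U2K5B58A82764035E78A82530467E51A12764035E34A10534672E54
    A10354672E61A63A64A65A76A6K86A6K2U0U0U0U0U2K5B51A127640385E34A105834672E54A
    103854672E61A63A64A65A76A6K6K7B0U0U0U0U2K8B81A127640358E84A103584672E87A65A
    86A6G43A104358672E61A6K7B63A6K7B51A53A54A5K5G0U0U0U61A6K7B63A6K7B64A6K7B51A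
    53A54A5K5G0U0U0U85A5G51A128764035E34A105346782E54A103546782E61A63A64A6K7B0U
    0U0U51A5K3B54A5K3B75A5K3B76A61A63A6K6G64A74A6K7B1035982746E6U0U2U2U76A61A7B
    127853046E6K6G51A75A53A5K5G54A5K3B63A64A6K7B104635872E0U0U2U2U51A75A53A5K5G
    3B5K5G2U2U86A7B61A127853046E43A106435872E63A104635872E0U91A1264035879E39A10
    46853972E49A1035864972E69C61A6K6G63A6K6G64A74A98A1035897462E6U6U0U61A127985
    3046E43A1064358972E63A1046358972E0Ua640358279E61A6K6G63A6K6G64A6U0U61A6K6G6
    3A6K6G64A6U0U61A6K6G63A6K6G64A6U0U64A6U6G61A1279a403586E34A1068534a972E36A1
    04a9785362E0U6K0U76A61A6G47A128530476E43A104358276E63A6U51A53A54A75A5K5G85A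
    5U2U0U0U0U97A1285304976E91A1267853049E93A1049358276E63A6U64A6U43A51A53A54A7
    5A5K5G85A5K5G1028769435E2U0U0U0U0U51A75A85A54A5K3B43A53A83A5K3B102764385E5U
    0U0U2U2U2U51A75A85A5G128764035E5K3B2U2U2U86A76A6N7B6G43A104358672E47A103586
    472E61A6U63A6U65A51A53A54A75A5K85A5K2U0U0U0U0U61A6K6G63A6K6G65A6K6G75A85A51
    A53A54A5K0U0U0U2U2U61A6K6G63A6K6G65A6K6G75A85A51A53A54A5K0U0U0U2U2U61A6K6G6
    3A6K6G65A6K6G75A85A51A53A54A5K0U0U0U2U2U61A6K6G63A6K6G65A6K6G75A85A51A53A54
    A5K0U0U0U2U2U7B47A1035869472E64A6U6G91A1276853049E93A1049358672E61A6U63A6U6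
    5A51A53A54A75A5K85A5K2U0U0U0U0U6K0U6K0U75A85A65A51A5K3B54A5K3B61A63A6K7B64A
    6K7B0U2U51A53A5U54A5K3B61A63A64A6K7B0U0U0U2U51A61A65A53A5K5G54A5K3B63A6K7B6
    4A6K7B0U2U2U2U201568C85A65A75A51A5K3B54A5K3B61A76A63A6K6G64A6K6G43A10435827
    6E0U0U2U2U51A54A5K3B61A76A63A6K6G5G83A104672835E7B74A103582746E01256C5K3B34
    A103467285E64A6K6G1N3N4N7N8N7052613874P825C726C406C305C10256C0U6K6G43A10435
    8276E53A5K3B1N3N4N7N8N7052613874P825C726C406C305C10256C0U6K6G5K3B2U2U2U51A6
    1A75A76A53A5U54A5K3B63A64A74A6K7B103582746E6U0U0U2U2U2U2U201567C2K5B51A1278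
    64035E34A105346872E54A103546872E61A63A64A65A86A6K6K8B0U0U0U0U2K5B51A1276840
    35E34A105348672E54A103548672E61A63A64A65A76A6K6K7B0U0U0U0U42A32A2G43A106435
    2E63A1046352E61A1035246E2N5B2K5B2K5B2K7B71A10462357E76A10357642E74A10357462
    E2U2K5B2K5B5B71A12640357E74A10357462E2N2G76A10357642E61A10357246E2U2K2G48A8
    2753064E68A82753046E78A82460357E76A10357642E61A10357246E2U2K2G43A106438572E
    63A104638572E76A103857642E61A103857246E51A53A54A65A75A5K8B81A84A85A5K5G86A8
    7A83A8K8G3B8K8G2U2U2U2U0U0U0U0U2K2G43A106435872E63A104635872E76A103587642E6
    1A103587246E51A53A54A65A81A84A86A87A3B8G8N5B103546278E8K5B8K9B91A1278460359
    E97A1035972468E96A1035964278E94A1035946278E8U8K5B8K5B5K5G2U2U2U2U0U0U0U0U2K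
    2G78A103578642E81A103572468E61A64A76A84A86A6K6G103572486E2U2U2U2U2U2K2G43A1
    06843572E63A104863572E76A103576842E61A103572486E51A53A54A64A65A75A5U81A84A8
    6A87A3B8N8G103572468E8K8G103572468E8K8G1035972468E8K8G1035724698E8K6B103572
    6498E5K5G2U2U2U2U0U0U0U0U0U32A5B71A10462357E74A10357462E2N2G61A12753046E67A
    10467532E63A10463572E2U2K2G68A82753046E78A82640357E61A12753046E67A10467532E
    63A10463572E2U2K2G61A127583046E43A106438572E67A104675832E63A104638572E51A53
    A54A65A73A75A5K8B81A83A85A5K5G86A87A3B104623758E8K8G2U2U2U2U2U0U0U0U0U2K2G6
    1A127853046E43A106435872E67A104678532E63A104635872E51A53A54A65A73A3B1037854
    62E5K5G2U0U0U0U0U2K2G81A127530468E87A104687532E83A104683572E61A63A76A86A6K6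
    G2U2U2U2U2K2G61A127530486E43A106843572E67A104867532E63A104863572E51A53A54A6
    5A73A75A5U3B103754862E5K5G2U0U0U0U0U2G61A1253046E43A1064352E63A1046352E0U71
    A12530467E73A10467352E65A76A7B61A63A6K6G64A6K6G43A10435276E51A53A54A3B5B78A
    127853046E81A127640358E2N2U2U2U5K5G0U0U0U43A51A53A54A3B10346725E5K5G0U0U0U0
    U64A63A6K6G5B81A127640358E87A104635872E2N2U2U2U2U43A51A53A54A3B10346725E5K5
    G0U0U0U0U43A51A53A54A3B10346725E5K5G0U0U0U0U61A6K6G63A6K6G64A6K6G43A51A53A5
    4A75A5K5G85A5K5G74A106874352E84A106784352E6U0U0U0U0U0U64A6G61A43A10435276E6
    3A6K7B51A53A54A3B5N5G5K5G5K5G38A103827645E48A103548276E81A103546728E5U5K5G5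
    K5G0U0U0U63A5B81A127640358E84A103584672E86A6K7B87A43A104358762E51A53A54A85A
    5U3B2N2U2U2U2U5K5G0U0U0U2U43A51A53A54A3B10346725E5K5G0U0U0U0U61A6K7B63A6K7B
    43A51A53A54A3B103486725E5K5G0U0U0U0U63A61A7B6K6G43A51A53A54A3B10346725E5K5G
    0U0U0U0U43A51A53A54A3B10346725E5K5G0U0U0U0U54A53A51A43A5G83A104672835E81A10
    3546728E5N3B103467285E5K3B103467285E5K9B91A1046728539E98A1039827645E94A1039
    467285E5U5K3B1034672985E5K3B1034697285E5K3B1034967285E61A63A64A76A6U6G6N7B6
    K7B6K7B6K7B6K8B81A104635278E84A103527846E6U6K7B0U0U0U43A61A63A64A6G10435276
    E6K7B0U0U0U0U43A61A63A64A6G10435276E6K7B0U0U0U0U43A61A63A64A6G10435276E6K7B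
    0U0U0U0U52A42A32A5B34A1053462E51A1046235E54A1035462E2N2G2K2G2K2G2K2G73A1046
    7352E57A10357642E71A10352467E2U2K2G2K2G2G73A10467352E71A10352467E2N5B51A127
    64035E57A10357642E54A10354672E2U2K5B58A82764035E78A82530467E51A12764035E57A
    10357642E54A10354672E2U2K5B51A127640385E34A105834672E57A103857642E54A103854
    672E53A81A84A85A87A83A8U8G104672538E8K3B2U2U2U2U0U2K8B81A127640358E87A10358
    7642E84A103584672E51A54A75A85A5K3B2U2U2U2U2K5B51A127864035E57A103578642E54A
    103546872E74A81A84A85A87A7B103527468E8K8G2U2U2U2U2U2K5B51A127684035E34A1053
    48672E54A103548672E61A63A64A65A76A6K6G86A6K7B7B6K6G0U0U0U0U32A2G71A12530467
    E73A10467352E2N5B75A10467532E51A10467235E2U2K5B38A82764053E58A82764035E78A8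
    2350467E75A10467532E51A10467235E2U2K5B34A105834672E75A104675832E51A10467238
    5E54A103854672E53A61A63A64A65A76A6U81A83A85A87A6G8N3B104672358E8K3B10467235
    8E8K8G1046725398E8K3B1046723598E8K3B1046972358E6K7B2U2U2U2U0U0U0U0U0U2K8B78
    A104678532E81A104672358E51A53A75A83A85A5K3B104672385E2U2U2U2U2U2K5B34A10534
    6872E75A104687532E51A104687235E54A103546872E61A63A64A65A81A83A85A87A7B6G8N8
    G104635278E8K8G8K8G8K8G91A1278350469E97A1046972358E95A1046953278E93A1046935
    278E8U6K8B8K8G2U2U2U2U0U0U0U0U2K5B34A105348672E75A104867532E51A104867235E54
    A103548672E61A63A64A65A76A6K6G81A83A85A86A6K7B87A84A8K6B7B6K6G2U2U2U2U0U0U0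
    U0U2G71A12530467E73A10467352E65A76A75A5N3B5G51A12764035E34A10346752E54A1035
    4672E0U51A5K3B54A5K3B61A63A64A74A6K7B10352746E6U0U0U0U5G51A127640385E34A105
    834672E54A103854672E0U5K0U51A5K3B54A5K3B61A63A64A74A6K7B103582746E6U0U0U0U5
    1A5K3B54A5K3B61A63A64A86A6K6K8B0U0U0U51A5K3B54A5K3B61A63A64A86A6K6K6G0U0U0U
    74A64A61A6N7B10352746E6K7B10352746E6K7B103852746E6K7B103582746E6K6G12530478
    6E6K7B103527486E63A6N6G10476352E6K6G10476352E6K6G104763852E6K6G104763582E6K
    6G104786352E6K7B6G83A106748352E87A104876352E54A746C948603527E43A4K8B51A53A8
    5A5K6U0U0U43A4K8B51A53A85A5K6U0U0U9B1047986352E4K6U51A53A85A5K5G102748635E6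
    U0U0U43A51A53A54A5K5G10276435E0U0U0U0U63A61A7B10352746E6K6G43A51A53A54A5K5G
    10276435E0U0U0U0U43A51A53A54A5K5G10276435E0U0U0U0U64A63A61A6K601345C6G7B54A
    5N3B5G10354672E51A5K3B53A5K5G10354672E0U5G103854672E5K0U51A5K3B53A5K3B5G78A
    103546782E43A27C928503467E9B1034658972E2U0U0U43A51A53A5N5G10276435E5K5G1027
    6435E5K5G102764385E5K3B103467285E0U0U0U48A104876352E83A104678352E43A53A54A8
    5A5K3B5G103456872E6U6U6U6U6K87A104876352E603458C61A76C6K7B86403527E6K6G43A1
    04385276E51A53A54A85A5K5K8B0U0U0U6K6G43A104358276E51A53A54A85A5K5K5G0U0U0U6
    K8B81A125304678E84A103527846E6U6K7B6G103527846E43A51A53A54A5K5G10276435E0U0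
    U0U0U63A6G87A104876352E61A6K601358C43A51A53A54A5K5G102768435E0U0U0U0U43A51A
    53A54A5K5G10276435E0U0U0U0U75A5N3B5G51A12764035E34A10346752E54A10354672E0U5
    1A5K3B54A5K3B43A53A5K3B10346752E0U0U5G51A127640385E34A105834672E54A10385467
    2E0U5K0U51A5K3B54A5K3B43A53A5K3B103467582E0U0U51A5K3B54A5K3B43A53A5K3B10346
    8752E0U0U51A5K3B54A5K3B43A53A5K3B103486752E0U0U64A63A61A6G43A10435276E53A3B
    6N7B6K7B6K7B6K8B81A104635278E84A103527846E68C51A104638725E54A103872546E0U5G
    104635872E5K0U5G51A127640385E54A103854672E0U5K0U51A54A5G10354672E5K3B0U0U6K
    7B54A5N3B5G10354672E51A5K3B53A5K5G10354672E0U5G103854672E5K0U51A5K3B53A5K3B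
    5G78A103546782E81A103546728E43A27C928503467E9B1034679852E2U82A2U8B2U82A2U8B
    2U0U0U51A5K3B53A5K5G103546872E0U51A5K3B53A5K5G103548672E0U43A51A53A5N5G1027
    6435E5K5G10276435E5K5G102764385E5K3B103467285E5K5G102786435E5K5G102768435E0
    U0U0U54A5N3B5G10354672E51A5K3B53A5K5G10354672E0U5G103854672E5K0U51A5K3B53A5
    K3B5G78A103546782E81A103546728E43A27C928503467E9B1034679852E2U82A2U8B2U82A2
    U8B2U0U0U51A5K3B53A5K5G103546872E0U51A5K3B53A5K5G103548672E0U43A51A53A5N5G1
    0276435E5K5G10276435E5K5G102764385E5K3B103467285E5K5G102786435E5K5G10276843
    5E0U0U0U54A5N3B5G10354672E51A5K3B53A5K5G10354672E0U5G103854672E5K0U51A5K3B5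
    3A5K3B5G78A103546782E81A103546728E43A27C928503467E9B1034679852E2U82A2U8B2U8
    2A2U8B2U0U0U51A5K3B53A5K5G103546872E0U51A5K3B53A5K5G103548672E0U43A51A53A5N
    5G10276435E5K5G10276435E5K5G102764385E5K3B103467285E5K5G102786435E5K5G10276
    8435E0U0U0U64A63A61A43A6G10435276E83A104835276E81A103527648E87A102534876E76
    A6U6N7B6K7B6K7B6K7B6K9B91A1048635279E98A1035279846E94A1035279486E6U6K7B51A5
    3A54A5N5G10354672E5K5G10354672E5K5G103854672E5K3B5G38A103827645E81A10354672
    8E5U5K5G103546872E5K5G103548672E0U0U0U43A51A53A54A5N5G10276435E5K5G10276435
    E5K5G102764385E5K3B103467285E5K5G102786435E5K5G102768435E0U0U0U0U43A51A53A5
    4A5N5G10276435E5K5G10276435E5K5G102764385E5K3B103467285E5K5G102786435E5K5G1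
    02768435E0U0U0U0U43A51A53A54A5N5G10276435E5K5G10276435E5K5G102764385E5K3B10
    3467285E5K5G102786435E5K5G102768435E0U0U0U0U42A32A2G73A10467352E71A10352467
    E2N5B2K5B2K5B2K8B81A104672358E87A103587642E84A103584672E2U2K5B2K5B2G71A1035
    2467E5B81A127640358E87A103587642E84A103584672E2N2U2U2U2U2U2U32A2G71A1253046
    7E73A10467352E5B78A104678532E81A104672358E2N2U2U2U2U2U2U64A63A61A65A6G43A10
    43526E51A53A54A3B6N2B6K2B6K2B6K7B37A10372546E71A10364527E74A10352746E75A5K5
    G6U5K5G0U0U0U6K2B43A6G1043526E73A10473526E71A10352647E6N2B6K2B6K2B6K2B6K8B8
    1A104763528E87A103528746E84A103528476E6U6K2B0U43A51A53A54A65A3B1034625E5K5G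
    0U0U0U0U0U43A51A53A54A65A3B1034625E5K5G0U0U0U0U0U43A51A53A54A65A3B1034625E5
    K5G0U0U0U0U0U");
  (hub false 4 [:: (4, false); (0, false); (3, true); (6, true); (5, true);
                 (2, true)], "
    0K31A1042563E41A1036524E5B51A1240365E34A1056342E54A1036542E42A62A2G32A2K64A
    61A6G53A1042536E63A6K3B1N3N4N5N50261345P5026C4026C3026C1026C3G302C73A104257
    36E47A10364752E71A10364257E63A6U65A6K3B67C6K3B6K8B103875246E6K3B1N65A3B35A1
    035642E6N6G3N4N20261345P4026C3026C6K6G37A7640523E47A7630524E57A7630425E6U6K
    6G37A10375642E47A10364752E3N4N20261345P4026C4026C3026C3026C75A10375642E74A1
    0374652E67C6K6G35A10467352E4N5N20261453P5026C5026C4026C4026C6K6G86405237E6K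
    6G35A104678352E0U6K6G103785642E53A63A6G37A10463752E47A10364752E67C6K3B10357
    642E6K8B104638752E6K3B103587642E0U0U102C102C102C4N61A65A6G53A1042536E63A6N3
    B1N3N20264135P3026C1026C6K3B37A7650423E57A7630425E3N5N20264351P5026C3026C6K
    7B71A10425637E75A10423756E1N5N20264153P5026C5026C1026C1026C0U73A10425736E71
    A10423657E6N3B35A10423576E1N3N20264135P3026C3026C1026C1026C6K3B6K8B81A16750
    4238E87A104238756E85A104238576E6U6K3B53A63A6G71A10426357E73A10425736E67C6K3
    B10423576E6K8B104257836E6K3B104235876E0U0U53A63A65A1N10235614P102C102C102C0
    U0U0U402C402C402C65A6G64A35A1046352E61A63A6K3B3N2N1N4N20623145P4026C1026C2K
    47A7250364E57A7240365E4N5N20623451P5026C4026C306C0U0U53A61A1042536E0U0U64A6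
    1A6K3B63A6K3B35A10357642E0U0U53A61A63A6K3B12403576E0U0U0U53A61A63A64A3B1035
    642E6K6G0U0U0U0UR22105764L32A2G65A64A63A3B35A1035642E61A6N6U6K6G37A7640523E
    47A7630524E57A7630425E6U6K6G37A10375246E47A10324756E71A10324657E6U0U71A1042
    5637E75A10375642E74A10374652E61A6U53A6N6G10467352E6K6G10467352E6K6G10467835
    2E6K6G38A104673852E78A103785642E48A103764852E6U0U53A61A3B75A10375642E47A102
    47356E71A10246537E6G10425376E6U0U0U53A61A63A3B1042356E71A10425637E75A104237
    56E6N6G10425376E6K6G10425376E6K6G104253876E6K6G83A104258376E78A104237856E81
    A104237658E6U0U0U0U53A61A63A64A6G73A10425736E47A10247536E71A10246357E3B1035
    7642E6U0U0U0U0U73A10473652E57A10365742E71A10365247E2U53A61A63A64A65A6N3B6G1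
    035246E6K3B6G1035246E6K6G10425376E6K3B10357642E6K3B6G10352746E0U0U0U0U0U64A
    62A2G71A12563047E73A10473652E32A2K75A10475632E76A65A61A6K3B63A6K3B35A103564
    72E0U0U61A63A6K6G0U0U201356C53A61A63A65A6K3B6G10352746E0U0U0U0U53A61A63A65A
    6N3B6G1035246E6K3B6G1035246E6K6G10425376E6K3B10357642E6K3B6G10352746E0U0U0U
    0U012356C71A12403657E74A10365742E51A20153462L2G43A10436572E62A52A2K61A22164
    705L1N75A64A6G35A10463572E45A10364572E0U38A104638572E48A103648572E68C76A6K3
    B53A5K2U54A63A5K6K3B8B5G37A103758642E87A103645872E3N4N7N8N7025641783P856C72
    5C40256C306C0U0U63A6U65A6K3B0U963042758E63A6K2U65A6K9B94A1039468572E53A54A8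
    5A5K95A5K6U0U0U0U63A6K2U65A6K3B0U63A6K2U65A6K3B0U53A54A65A76A5K6B10367542E2
    U0U0U0U54A64A65A76A6G10364572E6K3B2U2U2U2U102C102C102C102C32A76A64A63A61A6K
    6G73A3B10375642E6K6G2U61A65A6K3B3B6K6G2U61A63A73A3B10423756E6K6G2U2U2U61A63
    A64A73A3B10375642E6K6G2U2U2U2U63A54A6B61A12754036E64A10364572E0U87A10368754
    2E84A103684572E53A5G37A104586372E5N65A76A86A6K0U5U5U5U5U5U5U39A1045863972E8
    9A1045368972E49A1036854972E75A5U5N65A86A96A6K0U5U5U5U5U5U5U5U61A64A65A86A6K
    6K6G0U0U0U53A61A64A65A6K3B6G10357246E0U0U0U0U54A61A64A65A6G10364572E6K3B0U0
    U0U0U52A32A53A54A73A75A5G10456372E5K6B2U2U2U2U64A63A61A6G53A10427536E45A103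
    64572E0U83A104275836E48A103648572E81A103642758E65A6U76A6U3B6N6U6U6U6U6U53A5
    4A65A6B10364572E5K5G0U0U0U53A54A65A6B10364572E5K5G0U0U0U53A54A61A65A6B10427
    536E5K5G0U0U0U0U32A2N2U48A82756304E78A82403657E2U73A81A83A84A87A3B103756842
    E8K8G2U2U2U2U2U81A83A84A87A85A8K6B86A8K8G6B8K8G2U2U2U2U73A81A83A84A87A8G104
    273658E8K5B2U2U2U2U2U53A54A61A63A64A65A6N3B6G10357246E6K3B6G10357246E6K6G10
    3864572E6K3B6G38A103857246E48A103648572E81A103642758E6U6K3B6G103587246E0U0U
    0U0U0U0U81A127563048E83A104836572E42A78A103657842E32A2U52A2U2N62A64A76A86A6
    1A63A6K6K3B2U2U2U2U2U2U2U2U2U2U32A87A104875632E52A2U2N62A63A76A86A61A65A6K6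
    K6G2U2U2U2U2U2U2U2U2U2U62A52A61AR22167850L87A86A85A76A65A64A6K3B53A54A75A5K
    5K5G0U0U63A64A6K6G0U0U65A75A6B43A105784362E35A104863572E64A103648572E45A103
    684572E0U5K0U2U2U65A76A64A6K3B43A63A6K3B103486572E0U0U2U2U65A75A76A85A6B34A
    105763482E53A104875362E64A103648572E54A103675482E0U5K0U2U2U2U2U65A75A76A85A
    86A64A6K3B53A54A5K0U0U2U2U2U2U2U65A64A6N3B6G61A35A103572846E34A103482756E0U
    43A53A76A103576482E87A103487562E86A103486572E2U0U0U61A6K3B43A63A76A6K86A6K8
    7A6K3B103487562E2U0U0U76A6K0U86A6K0U9B98A1039846572E97A1039756482E92A2U6G6N
    2N2U2U2U2U2U6K0U6K0U6K0U6K0U6K0U6K0U61A6K3B43A63A76A6K86A6K87A6K3B103487596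
    2E2U0U0U61A6K3B43A63A76A6K86A6K87A6K3B1034879562E2U0U0U61A6K3B43A63A76A6K86
    A6K87A6K3B1034987562E2U0U0U43A53A61A63A6N3B103482756E6K3B103482756E6K6G1048
    275396E6K3B1034827596E6K3B1034827956E6K3B1034982756E0U0U0U0U43A61A63A64A3B1
    03482756E6K6G0U0U0U0U52A64A63A61A3B37A103756482E34A103482756E53A54A65A76A6U
    75A5U6B103572846E5K5G0U0U0U91A1048275639E94A1039482756E6N6G43A1057284396E53
    A1048275396E0U6K6G6K6G6K6Ga3A1048275a396E9aA1039a572846Ea1A1039648275aE6U6K
    6G6K6G53A54A65A85A5K5G6B87A103648752E75A5K5G2N2U2U2U2U2U5K5G0U0U0U53A54A61A
    65A6B104827536E5K5G0U0U0U0U53A54A61A65A6B104827536E5K5G0U0U0U0U43A53A61A63A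
    64A65A6N3B103482756E6K3B103482756E6K6G1048275396E6K3B1034827596E6K3B1034827
    956E6K3B1034982756E0U0U0U0U0U0U");
  (hub true 3 [:: (4, false); (0, false); (3, true); (2, true)], "
    35A50423E45A50324E31A10423E41A10324E2G43A10432E32A51A52A2N3B3N4N0021534P402
    C302C2K3B36A62403E46A62304E2U2K6B65A504236E61A104236E64A103642E2U0U0U0U61A1
    23046E63A104632E43A65A502346E3B103462E75A5026437E74A1037462E71A1026437E27C6
    7A1046732E42A2U52A2U0U32A1046732E42A1037642E0U8264037E32A2K0U42A52A2K0U0U32
    A2K0U42A52A2K0U0U32A42A52A2U0U0U0U");
  (hub true 3 [:: (4, false); (0, false); (3, true); (5, true); (2, true)], "
    31A104253E41A103524E5B51A124035E34A105342E54A103542E32A42A53A2N2G1N4N002351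
    4P402C402C102C102C2K2G36A624053E56A624035E46A623504E2U2K2GR32105436L2K2G63A
    1046352E56A1035642E61A1035246E2U0U0U0U61A1240356E64A1035642E2G43A1043562E32
    A2N52AR32106435L2U47A7265304E67A7240356E2U63A71A73A74A76A3B10365742E7K7G2U2
    U2U2U2U63A71A73A74A76A7G10426357E7K5B2U2U2U2U2U53A52A2N65A5G63A45A1045362E5
    1A1042635E0U5N3B1N3N4N6N54A51A5U60254163P51A60251463P0U625C4025C305C1025C67
    A7530426E51A5U54A5U0U7B47A10473562E71A10426537E51A5U54A5U0U5K0U71A12403567E
    74A10356742E3B63A51A12403675E54A10367542E0U51A5U54A5U0U5K0U20145C47A7265304
    E67A7240356E51A54A65A75A5K2U2U2U2UR32106475LR32106457L51A54A5G63A1042635E3B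
    5N5U5U5U73A10426735E47A10354762E71A10354267E65A5U3B5N5U5U5U5U0U0U01245C71A1
    2653047E73A10473562E42A67A10356742E32A2U2N52A54A65A75A51A53A5K5K3B2U2U2U2U2
    U2U2U2U2U32A76A10476532E63A2N52A53A65A75A51A5K3B10472365E2U2U2U2U2U2U2U2U2U
    2U52A2N76A51A5G12674035E87A126874035E81A125304768E83A104726835E267C84A10356
    8472E53A5U54A5U0U48A103574862E53A5U54A5U0U43A53A54A65A75A5K3B10347562E2U2U0
    U0U0U51A65A75A53A5U54A5K3B0U2U2U2U68A82740356E78A82653047E51A65A75A85A5K0U2
    U2U2U2UR32106785LR32106758LR22106758L43A51A53A54A3B10347265E81A104726538E84
    A103847265E86A102743865E65A5U5N5G5K5G5K5G5K5G93A1047269385E89A1038962745E91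
    A1038547269E5U5K5G0U0U0U0U");
  (start, "
    0N31A10423E41A10324E3B34A10342E42A2G4N2N1N3NS302C102C35A52403E2N2U2U25A5403
    2E402C62304E35A103542E51A103245E2N2U36A625403E56A623045E2U54A61A63A64A65A6N
    6G1032456E6K6G1032456E6K6G10324576E6K5B10325476E2U2U2U2U2U0U51A124035E54A10
    3542E2G43A104352E32A2N2U46A625304E56A624035E2U53A61A63A64A65A6N3B6G1035246E
    6K3B6G1035246E6K6G10425376E6K3B10357642E2U2U2U2U2U0U61A1253046E63A1046352E0
    12C65A1046532E42A2U2N2U2U2U2U56A1035642E32A2U2N2U2U2U2U0N4012345L00123456L1
    0123456LR10124356L0N5012345L10123465L30123456L30123465L20123456L0NR5012435L
    R10124365L20123465LR30124365LR30124356L")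
]%string.

(** The computation does not mention [G]; the hypotheses on [G] enter only through soundness. *)
Lemma certificates_valid : run_all [::] certificates.
Proof. by vm_compute. Qed.

Theorem theorem2 (G : sgraph)
  (Gconn : connected G)
  (Glconn : locally_connected G)
  (Gmin : 2 <= min_degree G)
  (Gmax : max_degree G = 5 \/ max_degree G = 6)
  (Gclust : (1 / 2%:R <= min_clustering G)%R) :
  fully_cycle_extendable G <->
  ([/\ ~ isomorphic G F1, ~ isomorphic G F2, ~ isomorphic G F3
     & ~ isomorphic G F4] /\
   [/\ ~ contains_strongly_induced G H1 S1,
       ~ contains_strongly_induced G H2 S2,
       ~ contains_strongly_induced G H3 S3,
       ~ contains_strongly_induced G H4 S4
     & ~ contains_strongly_induced G H5 S5]).
Proof.
have Gsparse v s U S := @sparse_nbhd G v s Gclust U S.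
have Gdeg (v : G) : degree v <= 6.
  apply: leq_trans (leq_bigmax v) _; rewrite -/(max_degree G).
  by case: Gmax => ->.
have Gbig : exists v : G, 4 < degree v.
  have [/existsP|] := boolP [exists v : G, 4 < degree v]; first by case=> v; exists v.
  rewrite negb_exists => /forallP H.
  have : max_degree G <= 4 by apply/bigmax_leqP => v _; rewrite leqNgt.
  by case: Gmax => ->.
rewrite -(avoids_patternsP Gconn); have [v0 _] := Gbig.
split=> [|Gpat]; first exact: fce_avoids v0.
split=> [v|c cc nc].
  (* The empty list of neighbours already yields degree at least 2, hence two neighbours [a] and
     [b]. *)
  have [||/card_gt1P[a [b [va vb ab]]] _] := @Gsparse v [::] => //.
  rewrite !inE in va vb.
  (* Within the neighbourhood of [v] some edge leaves [a], and with [v] it forms a triangle. *)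
  have [|a' [b' [_ /eqP-> vb' _ ab']]] := local_edge (A := pred1 a) Glconn va (eqxx a) vb.
    by rewrite !inE eq_sym.
  by exists a, b'; split; rewrite 1?adj_sym // adj_sym.
apply: extendable_NNP => // stuck_c.
have [f [g R]] := start_realized Gconn Glconn (conj cc stuck_c) nc.
have H : refuted_all G [seq d.1 | d <- certificates].
  exact: run_all_sound (I : refuted_all G [::]) certificates_valid.
(* Entry 6, counted from 0, is [start], the last of the certified states. *)
exact: (lemma_refuted (i := 6) H erefl) R.
Qed.
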